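(* Let $\Bbbk$ be a field. Let $M$ (resp. $\mathcal M$) be a simple supersolvable matroid (resp. simple supersolvable oriented matroid) of rank $r$ on $E=\{1,\dots,n\}$, and let $(E_1,\dots,E_r)$ be an ordered set partition of $E$ such that whenever $j\neq k$ lie in the same block $E_q$, there exist $p<q$ and $i\in E_p$ with $\{i,j,k\}$ a circuit. Let $A=\mathrm{OS}(M)$ or $A=\mathrm{VG}(\mathcal M)$ (these are Koszul), with Koszul dual $A^!=\Bbbk\langle y_1,\dots,y_n\rangle/J$. Then there exists a monomial ordering $\prec$ on $\Bbbk\langle y_1,\dots,y_n\rangle$ such that: (i) for $A=\mathrm{OS}(M)$, the set $\{r(j,F): F \text{ a rank-two flat},\ j\in F\}$ is a Gröbner basis for $J$, and $\{r(j,i): (j,i)\text{ a retrograde pair}\}$ is a reduced Gröbner basis for $J$, the $\prec$-initial term of $r(j,i)$ being $y_jy_i$; (ii) for $A=\mathrm{VG}(\mathcal M)$, the set $\{r^\pm(j,F): F\text{ a rank-two flat},\ j\in F\}$ is a Gröbner basis for $J$, and $\{r^\pm(j,i): (j,i)\text{ a retrograde pair}\}$ is a reduced Gröbner basis for $J$, the $\prec$-initial term of $r^\pm(j,i)$ being $y_jy_i$; (iii) in both cases the initial ideal of $J$ is generated by $\{y_jy_i: (j,i)\text{ a retrograde pair}\}$; (iv) hence in both cases the standard monomials form a $\Bbbk$-basis of $A^!$ consisting of all products $m_1m_2\cdots m_r$ where each $m_p$ is any noncommutative monomial in the variables $\{y_j\}_{j\in E_p}$; (v) $\operatorname{Hilb}(\mathrm{OS}(M)^!,t)=\operatorname{Hilb}(\mathrm{VG}(\mathcal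 M)^!,t)=\dfrac{1}{(1-e_1t)(1-e_2t)\cdots(1-e_rt)}$ where $e_p=|E_p|$.
   Context: Matroids: a matroid on $E$ is given by its circuits; simple means no circuits of size $\le 2$; flats are subsets $F$ such that every circuit $C$ with $|C\cap F|=|C|-1$ lies in $F$; they form a lattice with rank $r$ and join $\vee$. A flat $F$ is modular if $r(F\vee F')+r(F\wedge F')=r(F)+r(F')$ for all flats $F'$; supersolvable means there is a complete flag of modular flats. An oriented matroid $\mathcal M$ on $E$ is given by signed circuits $(C_+,C_-)$ (disjoint pairs satisfying the signed circuit axioms); its underlying matroid has circuits $C_+\cup C_-$, and ''simple'', ''supersolvable'', ''flat'' refer to it. For a rank-two flat $F$, the restriction $\mathcal M|_F$ is a rank-two oriented matroid, realizable by vectors $v_k\in\mathbb R^2$ ($k\in F$); fix one of its two chirotopes $\chi_F:F\times F\to\{0,\pm1\}$, $\chi_F(j,k)=\mathrm{sign}\det(v_j,v_k)$ (determined up to a global sign). Algebras: $\mathrm{OS}(M)=\bigwedge(x_1,\dots,x_n)/I$ with $I$ generated by $\partial x_C=\sum_{j=1}^k(-1)^{j-1}x_{c_1}\wedge\cdots\widehat{x_{c_j}}\cdots\wedge x_{c_k}$ for circuits $C=\{c_1<\dots<c_k\}$. $\mathrm{VG}(\mathcal M)=\Bbbk[x_1,\dots,x_n]/I$ with $I$ generated by all $x_i^2$ and, for each circuit $C$ with a chosen signed circuit $(C_+,C_-)$, $\partial^\pm x_C=\sum_{c\in C}\epsilon_C(c)\prod_{c'\in C\setminus\{c\}}x_{c'}$,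 $\epsilon_C(c)=+1$ if $c\in C_+$ and $-1$ if $c\in C_-$. Viewing either as a quadratic quotient $\Bbbk\langle x_1,\dots,x_n\rangle/I'$ of the free associative algebra, the Koszul dual is $A^!=\Bbbk\langle y_1,\dots,y_n\rangle/J$ with $J$ generated by $I_2'^\perp$ under the pairing $(y_iy_j,x_kx_\ell)=\delta_{ik}\delta_{j\ell}$. A monomial ordering on $\Bbbk\langle y\rangle$ is a well-ordering of noncommutative monomials compatible with two-sided multiplication. Relations: for a rank-two flat $F$ and $j\in F$, $r(j,F)=\sum_{k\in F\setminus\{j\}}(y_jy_k-y_ky_j)$ and $r^\pm(j,F)=\sum_{k\in F\setminus\{j\}}\chi_F(j,k)(y_jy_k+y_ky_j)$. A pair $(j,i)\in E^2$ is retrograde if $i\in E_p$, $j\in E_q$ with $p<q$; then with $F=\{j\}\vee\{i\}$: $r(j,i)=y_jy_i-y_iy_j+\sum_{k\in F\setminus\{i,j\}}(y_jy_k-y_ky_j)$ and $r^\pm(j,i)=y_jy_i+y_iy_j+\chi_F(j,i)\sum_{k\in F\setminus\{i,j\}}\chi_F(j,k)(y_jy_k+y_ky_j)$. *)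

(* Defs.v *)
From HB Require Import structures.
From mathcomp Require Import all_boot all_order all_algebra.
Set Implicit Arguments. Unset Strict Implicit. Unset Printing Implicit Defensive.
Import Order.TTheory GRing.Theory Num.Theory.
Local Open Scope ring_scope.

Definition circuit_axioms n (C : {set {set 'I_n}}) : Prop :=
  [/\ set0 \notin C,
      (forall C1 C2, C1 \in C -> C2 \in C -> C1 \subset C2 -> C1 = C2) &
      (forall C1 C2 e, C1 \in C -> C2 \in C -> C1 != C2 -> e \in C1 :&: C2 ->
         exists2 C3, C3 \in C & C3 \subset (C1 :|: C2) :\ e)].

Definition simple_matroid n (C : {set {set 'I_n}}) : Prop :=
  forall X, X \in C -> (2 < #|X|)%N.

Definition indep n (C : {set {set 'I_n}}) (I : {set 'I_n}) : bool :=
  [forall X : {set 'I_n}, (X \in C) ==> ~~ (X \subset I)].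

Definition mrank n (C : {set {set 'I_n}}) (X : {set 'I_n}) : nat :=
  \max_(I : {set 'I_n} | indep C I && (I \subset X)) #|I|.

Definition flat n (C : {set {set 'I_n}}) (F : {set 'I_n}) : bool :=
  [forall X : {set 'I_n}, (X \in C) ==> (#|X :&: F| == (#|X| - 1)%N) ==> (X \subset F)].

Definition closure n (C : {set {set 'I_n}}) (X : {set 'I_n}) : {set 'I_n} :=
  \bigcap_(F : {set 'I_n} | flat C F && (X \subset F)) F.

Definition mjoin n (C : {set {set 'I_n}}) (F F' : {set 'I_n}) : {set 'I_n} :=
  closure C (F :|: F').

Definition modular_flat n (C : {set {set 'I_n}}) (F : {set 'I_n}) : bool :=
  flat C F &&
  [forall F' : {set 'I_n}, flat C F' ==>
     (mrank C (mjoin C F F') + mrank C (F :&: F') == mrank C F + mrank C F')%N].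

Definition supersolvable n (C : {set {set 'I_n}}) : Prop :=
  exists Fl : nat -> {set 'I_n}, forall i, (i <= mrank C setT)%N ->
    [/\ modular_flat C (Fl i), mrank C (Fl i) = i &
        (i < mrank C setT)%N -> Fl i \subset Fl i.+1].

Definition rank2flat n (C : {set {set 'I_n}}) (F : {set 'I_n}) : Prop :=
  flat C F /\ mrank C F = 2%N.

(* ordered set partition (E_1,...,E_r) encoded by the block map blk : E -> 'I_r,
   E_p = [set i | blk i == p]; blocks are nonempty. *)
Definition good_partition n r (C : {set {set 'I_n}}) (blk : 'I_n -> 'I_r) : Prop :=
  (forall p : 'I_r, exists i, blk i = p) /\
  (forall j k, j != k -> blk j = blk k ->
     exists i, (blk i < blk j)%N /\ [set i; j; k] \in C).

Definition retrograde n r (blk : 'I_n -> 'I_r) (j i : 'I_n) : Prop := (blk i < blk j)%N.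

Definition block_size n r (blk : 'I_n -> 'I_r) (p : 'I_r) : nat := #|[set i | blk i == p]|.

Definition signed n := ({set 'I_n} * {set 'I_n})%type.
Definition ssupp n (X : signed n) : {set 'I_n} := X.1 :|: X.2.
Definition sneg n (X : signed n) : signed n := (X.2, X.1).

Definition om_axioms n (SC : {set signed n}) : Prop :=
  [/\ (forall X, X \in SC -> X.1 :&: X.2 = set0 /\ ssupp X != set0),
      (forall X, X \in SC -> sneg X \in SC),
      (forall X Y, X \in SC -> Y \in SC -> ssupp X \subset ssupp Y -> Y = X \/ Y = sneg X) &
      (forall X Y e, X \in SC -> Y \in SC -> X != sneg Y -> e \in X.1 :&: Y.2 ->
         exists2 Z, Z \in SC & (Z.1 \subset (X.1 :|: Y.1) :\ e) /\ (Z.2 \subset (X.2 :|: Y.2) :\ e))].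

Definition underlying n (SC : {set signed n}) : {set {set 'I_n}} := [set ssupp X | X in SC].

Definition det2 (R : realFieldType) (a b : R * R) : R := a.1 * b.2 - a.2 * b.1.

Definition vec_circuit (R : realFieldType) n (v : 'I_n -> R * R) (X : signed n) : Prop :=
  [/\ X.1 :&: X.2 = set0, ssupp X != set0,
      (exists lam : 'I_n -> R,
         [/\ forall k, k \in X.1 -> 0 < lam k,
             forall k, k \in X.2 -> lam k < 0,
             forall k, k \notin ssupp X -> lam k = 0,
             \sum_k lam k * (v k).1 = 0 &
             \sum_k lam k * (v k).2 = 0]) &
      (forall mu : 'I_n -> R, (forall k, mu k != 0 -> k \in ssupp X) ->
         \sum_k mu k * (v k).1 = 0 -> \sum_k mu k * (v k).2 = 0 ->
         (exists2 k, k \in ssupp X & mu k = 0) -> forall k, mu k = 0)].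

(* v realizes the rank-two oriented matroid M|_F: its signed circuits are exactly the
   sign vectors of the minimal linear dependencies among the v_k, k in F *)
Definition realizes (R : realFieldType) n (SC : {set signed n}) (F : {set 'I_n})
    (v : 'I_n -> R * R) : Prop :=
  forall X : signed n, ssupp X \subset F -> (X \in SC <-> vec_circuit v X).

Definition chi (K : fieldType) (R : realFieldType) n (v : 'I_n -> R * R) (j k : 'I_n) : K :=
  let d := det2 (v j) (v k) in if 0 < d then 1 else if d < 0 then -1 else 0.

(* noncommutative monomials = words; a polynomial is its coefficient function *)
Definition word n := seq 'I_n.
Definition ncpoly (K : Type) n := word n -> K.

Definition mono (K : fieldType) n (w : word n) : ncpoly K n := fun u => (u == w)%:R.

Definition fsupp (K : fieldType) n (p : ncpoly K n) : Prop :=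
  exists s : seq (word n), forall w, p w != 0 -> w \in s.

(* the polynomial  a * g * b  for words a b *)
Definition shift (K : fieldType) n (a : word n) (g : ncpoly K n) (b : word n) : ncpoly K n :=
  fun w => if [&& (size a + size b <= size w)%N, take (size a) w == a &
                  drop (size w - size b) w == b]
           then g (take (size w - size a - size b) (drop (size a) w)) else 0.

Definition ideal (K : fieldType) n (G : ncpoly K n -> Prop) (p : ncpoly K n) : Prop :=
  exists m (c : 'I_m -> K) (a b : 'I_m -> word n) (g : 'I_m -> ncpoly K n),
    (forall i, G (g i)) /\ forall w, p w = \sum_(i < m) c i * shift (a i) (g i) (b i) w.

Definition homog2 (K : fieldType) n (p : ncpoly K n) : Prop :=
  forall w, p w != 0 -> size w = 2%N.

(* OS(M) = K<x>/I' with I' generated by x_i^2, x_ix_j + x_jx_i and lifts of d x_C *)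
Definition OS_gens (K : fieldType) n (C : {set {set 'I_n}}) (p : ncpoly K n) : Prop :=
  [\/ exists i, forall w, p w = mono K [:: i; i] w,
      exists i j, forall w, p w = mono K [:: i; j] w + mono K [:: j; i] w |
      exists2 X, X \in C & forall w, p w =
        \sum_(c in X) (-1) ^+ (index c (enum X)) * (w == enum (X :\ c))%:R].

Definition sgn_eps (K : fieldType) n (X : signed n) (c : 'I_n) : K :=
  if c \in X.1 then 1 else -1.

(* VG(M) = K<x>/I' with I' generated by x_i^2, x_ix_j - x_jx_i and lifts of d^± x_C *)
Definition VG_gens (K : fieldType) n (SC : {set signed n}) (p : ncpoly K n) : Prop :=
  [\/ exists i, forall w, p w = mono K [:: i; i] w,
      exists i j, forall w, p w = mono K [:: i; j] w - mono K [:: j; i] w |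
      exists2 X, X \in SC & forall w, p w =
        \sum_(c in ssupp X) sgn_eps K X c * (w == enum (ssupp X :\ c))%:R].

Definition I2 (K : fieldType) n (Igens : ncpoly K n -> Prop) (p : ncpoly K n) : Prop :=
  ideal Igens p /\ homog2 p.

Definition pair2 (K : fieldType) n (q p : ncpoly K n) : K :=
  \sum_(i < n) \sum_(j < n) q [:: i; j] * p [:: i; j].

Definition dual_gens (K : fieldType) n (Igens : ncpoly K n -> Prop) (q : ncpoly K n) : Prop :=
  homog2 q /\ forall p, I2 Igens p -> pair2 q p = 0.

Definition koszul_dual_ideal (K : fieldType) n (Igens : ncpoly K n -> Prop) :=
  ideal (dual_gens Igens).

Definition monomial_order n (ord : rel (word n)) : Prop :=
  [/\ irreflexive ord, transitive ord,
      (forall u v, u != v -> ord u v || ord v u),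
      well_founded (fun u v => ord u v) &
      (forall a b u v, ord u v -> ord (a ++ u ++ b) (a ++ v ++ b))].

Definition is_lm (K : fieldType) n (ord : rel (word n)) (p : ncpoly K n) (w : word n) : Prop :=
  p w != 0 /\ forall u, p u != 0 -> u != w -> ord u w.

Definition groebner (K : fieldType) n (ord : rel (word n))
    (G J : ncpoly K n -> Prop) : Prop :=
  (forall g, G g -> J g) /\
  (forall p u, J p -> is_lm ord p u ->
     exists g w, [/\ G g, is_lm ord g w & infix w u]).

Definition reduced_groebner (K : fieldType) n (ord : rel (word n))
    (G J : ncpoly K n -> Prop) : Prop :=
  [/\ groebner ord G J,
      (forall g, G g -> exists w, is_lm ord g w /\ g w = 1) &
      (forall g g', G g -> G g' -> (exists w, g w != g' w) ->
         forall u w, g u != 0 -> is_lm ord g' w -> ~~ infix w u)].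

Definition initial_ideal (K : fieldType) n (ord : rel (word n)) (J : ncpoly K n -> Prop) :=
  ideal (fun m => exists p w, [/\ J p, is_lm ord p w & forall u, m u = mono K w u]).

Definition standard (K : fieldType) n (ord : rel (word n)) (J : ncpoly K n -> Prop)
    (w : word n) : Prop :=
  ~ exists p u, [/\ J p, is_lm ord p u & infix u w].

Definition basis_mod (K : fieldType) n (J : ncpoly K n -> Prop) (S : word n -> Prop) : Prop :=
  (forall p, fsupp p -> exists q, [/\ fsupp q, (forall w, q w != 0 -> S w) &
                                   J (fun w => p w - q w)]) /\
  (forall q, fsupp q -> (forall w, q w != 0 -> S w) -> J q -> forall w, q w = 0).

Definition graded_dim (K : fieldType) n (J : ncpoly K n -> Prop) (d m : nat) : Prop :=
  exists f : 'I_m -> ncpoly K n,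
    [/\ forall i, fsupp (f i),
        forall i w, f i w != 0 -> size w = d,
        (forall c : 'I_m -> K, J (fun w => \sum_i c i * f i w) -> forall i, c i = 0) &
        (forall p, fsupp p -> (forall w, p w != 0 -> size w = d) ->
           exists c : 'I_m -> K, J (fun w => p w - \sum_i c i * f i w))].

(* Hilb(K<y>/J, t) = 1 / prod_p (1 - e_p t), i.e. Hilb * prod_p (1 - e_p t) = 1 *)
Definition hilbert_is (K : fieldType) n r (J : ncpoly K n -> Prop) (e : 'I_r -> nat) : Prop :=
  exists h : nat -> nat, (forall d, graded_dim J d (h d)) /\
    let P : {poly int} := \prod_(p < r) (1 - (e p)%:R *: 'X) in
    forall d, \sum_(k < d.+1) (h (d - k)%N)%:R * P`_k = (d == 0%N)%:R.

Definition r_flat (K : fieldType) n (F : {set 'I_n}) (j : 'I_n) : ncpoly K n :=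
  fun w => \sum_(k in F | k != j) ((w == [:: j; k])%:R - (w == [:: k; j])%:R).

Definition r_retro (K : fieldType) n (C : {set {set 'I_n}}) (j i : 'I_n) : ncpoly K n :=
  let F := mjoin C [set j] [set i] in
  fun w => (w == [:: j; i])%:R - (w == [:: i; j])%:R +
           \sum_(k in F | (k != i) && (k != j)) ((w == [:: j; k])%:R - (w == [:: k; j])%:R).

Definition rpm_flat (K : fieldType) (R : realFieldType) n (v : 'I_n -> R * R)
    (F : {set 'I_n}) (j : 'I_n) : ncpoly K n :=
  fun w => \sum_(k in F | k != j) chi K v j k * ((w == [:: j; k])%:R + (w == [:: k; j])%:R).

Definition rpm_retro (K : fieldType) (R : realFieldType) n (C : {set {set 'I_n}})
    (v : {set 'I_n} -> 'I_n -> R * R) (j i : 'I_n) : ncpoly K n :=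
  let F := mjoin C [set j] [set i] in
  fun w => (w == [:: j; i])%:R + (w == [:: i; j])%:R +
           chi K (v F) j i * \sum_(k in F | (k != i) && (k != j))
              chi K (v F) j k * ((w == [:: j; k])%:R + (w == [:: k; j])%:R).

Definition common_conclusions (K : fieldType) n r (blk : 'I_n -> 'I_r)
    (ord : rel (word n)) (J : ncpoly K n -> Prop) : Prop :=
  [/\
      (forall p, initial_ideal ord J p <->
         ideal (fun m => exists j i, retrograde blk j i /\
                          forall u, m u = mono K [:: j; i] u) p),
      (forall w, standard ord J w <-> sorted leq (map (fun i => nat_of_ord (blk i)) w)),
      basis_mod J (standard ord J) &
      hilbert_is J (block_size blk)].

Arguments OS_gens K {n} C p.
Arguments VG_gens K {n} SC p.
Arguments r_flat K {n} F j w.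
Arguments r_retro K {n} C j i w.
Arguments rpm_flat K {R n} v F j w.
Arguments rpm_retro K {R n} C v j i w.
Arguments mono K {n} w u.

(* Main.v *)
Require Import Defs.
From HB Require Import structures.
From mathcomp Require Import all_boot all_order all_algebra.
From mathcomp Require Import ring zify.

(* The dual ideal is spanned in degree two by the line relations
   [y_j, \sum_h c j h y_h]_s = 0, where [_, _]_s is the commutator or the anticommutator and
   c is 1 or the chirotope. The circuit condition on the blocks together with the rank forces
   every line to have one point in some block and all its other points in one later block, so
   that for the order below y_j y_i leads the relation of (j, i). The relations thus rewrite
   words into block-sorted words, and it remains to see that no two block-sorted words become
   dependent modulo the ideal.

   For this one lets y_i act on the right on block-sorted words: moving y_i to the left past a
   letter y_k of a later block contributes a derivation of the free algebra on that block.
   These derivations satisfy the line relations: a plane meets the earlier blocks in a line G,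
   and the second-order terms coming from G cancel in pairs by the Jacobi identity, each pair
   being attached to a complete quadrilateral with one side on G. In the oriented case the
   signs match by the oriented form of Menelaus' theorem, which follows from two signed
   circuit eliminations. Hence the action factors through the dual algebra, and applying a
   word to 1 computes its normal form. *)

Set Implicit Arguments. Unset Strict Implicit. Unset Printing Implicit Defensive.
Import Order.TTheory GRing.Theory Num.Theory.
Local Open Scope ring_scope.

(** * The action of letters on normal words *)

(** Rewriting alone gives spanning; resolving all overlaps of the relations would be a case analysis
    on words of length three, which the action replaces. Its model is an iterated semidirect product
    of free Lie algebras (free Lie superalgebras on odd letters when [s = -1]): each block generates
    a free factor on which the earlier blocks act by derivations, and words sorted by blocks are the
    PBW-type basis of the enveloping algebra. The action is carried by linear functionals on words
    and not by polynomials. A functional needs no finite support, a product of letters becomes a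
    nesting of functionals, and since everything is defined on all words, sorted or not, the
    relations are proved by plain induction on the word. The functional reading the coefficient of
    one word [u] then does double duty: it shows that sorted words are independent and, because
    moving a letter never produces a word larger than the original one, that the leading word of an
    element of the ideal is never sorted. *)

Lemma eq_big_unique (K : nmodType) (I : finType) (P Q : pred I) (F G : I -> K) :
  {in P &, forall x y, x = y} -> {in Q &, forall x y, x = y} ->
  (forall x, P x -> exists2 y, Q y & F x = G y) ->
  (forall y, Q y -> exists x, P x) ->
  \sum_(x | P x) F x = \sum_(y | Q y) G y.
Proof.
move=> uP uQ PQ QP; case: (pickP P) => [x Px | P0].
  have [y Qy e] := PQ x Px.
  rewrite (big_pred1 x) => [|z]; last first.
    by apply/idP/eqP => [Pz | ->//]; apply: uP.
  rewrite (big_pred1 y) ?e // => z.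
  by apply/idP/eqP => [Qz | ->//]; apply: uQ.
rewrite !big1 // => y Qy; last by rewrite P0 in Qy.
by have [x] := QP y Qy; rewrite P0.
Qed.

(** The terms at [(l, m)] and [(m, l)] are paired explicitly: in characteristic two the sum could
    not be deduced from being its own opposite, and the diagonal needs its own hypothesis. *)
Lemma sum_antisym (K : zmodType) n (F : 'I_n -> 'I_n -> K) :
  (forall l, F l l = 0) -> (forall l m, F l m = - F m l) ->
  \sum_l \sum_m F l m = 0.
Proof.
move=> F0 FN.
have E l : \sum_m F l m =
    \sum_(m : 'I_n | (l < m)%N) F l m + \sum_(m : 'I_n | (m < l)%N) F l m.
  rewrite (bigID (fun m : 'I_n => (l < m)%N)) /=; congr (_ + _).
  rewrite (bigD1 l) ?ltnn //= F0 add0r; apply: eq_bigl => m.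
  by rewrite -leqNgt [RHS]ltn_neqAle andbC.
rewrite (eq_bigr _ (fun l _ => E l)) big_split /=.
rewrite [X in _ + X](exchange_big_dep xpredT) //=.
rewrite -big_split big1 // => l _.
by rewrite -big_split big1 //= => m _; rewrite [F m l]FN subrr.
Qed.

(* The incidence geometry retained from a good partition: lines are rank-two flats,
   [col_top] says that the unions of initial blocks are closed, and [col_pasch] that a
   plane meets such a union in a line when it is not contained in it. *)
Record plane_axioms n r (blk : 'I_n -> 'I_r) (col : 'I_n -> 'I_n -> 'I_n -> bool) : Prop := {
  col_rot : forall a b c, col a b c = col b c a;
  col_swap : forall a b c, col a b c = col b a c;
  col_irr : forall a b, col a a b = false;
  col_trans : forall a b c d, col a b c -> col a b d -> c != d -> col a c d;
  col_low : forall a b, a != b -> blk a = blk b ->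
    exists i, (blk i < blk a)%N /\ col i a b;
  col_top : forall a b c, col a b c -> ~~ ((blk b < blk a) && (blk c < blk a))%N;
  col_pasch : forall j h h' k l m, blk k = blk l -> blk l = blk m ->
    (blk j < blk k)%N -> (blk h < blk k)%N -> (blk h' < blk k)%N ->
    col j k l -> col h k m -> col h' l m -> j != h -> h != h' -> col j h h'
}.

(* The Orlik-Solomon case is [s = 1], [c = 1]; the Varchenko-Gelfand case is [s = -1] and
   [c j k] the chirotope of the line through [j] and [k]. The relations of a line are then
   [\sum_h c j h (y_j y_h - s y_h y_j)] in both cases. *)
Record sign_axioms n (K : fieldType) (col : 'I_n -> 'I_n -> 'I_n -> bool)
    (s : K) (c : 'I_n -> 'I_n -> K) : Prop := {
  sign_ss : s * s = 1;
  sign_sym : forall a b, a != b -> c a b = s * c b a;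
  sign_sq : forall a b, a != b -> c a b * c a b = 1;
  sign_menelaus : forall j h h' k l m, col j h h' -> col j k l -> col h k m ->
    col h' l m -> ~~ col j h k ->
    c j h * c k h * c k m = c j h' * c l h' * c l m
}.

Section NormalForm.
Variables (K : fieldType) (n r : nat) (blk : 'I_n -> 'I_r).
Variables (col : 'I_n -> 'I_n -> 'I_n -> bool) (s : K) (c : 'I_n -> 'I_n -> K).
Hypothesis plane : plane_axioms blk col.
Hypothesis sgn : sign_axioms col s c.

Let rot := col_rot plane.
Let swap := col_swap plane.
Let ss := sign_ss sgn.

Lemma ctr a b d e : col a b d -> col a b e -> d != e -> col a d e.
Proof. by move=> h1 h2 h3; apply: (col_trans plane h1 h2 h3). Qed.

Lemma col_rot2 a b d : col a b d = col d a b.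
Proof. by rewrite rot rot. Qed.

Lemma col_swap23 a b d : col a b d = col a d b.
Proof. by rewrite swap rot. Qed.

Lemma col_rev a b d : col a b d = col d b a.
Proof. by rewrite swap rot rot. Qed.

Ltac colp := by first [assumption | rewrite swap; assumption | rewrite rot; assumption
  | rewrite col_rot2; assumption | rewrite col_swap23; assumption | rewrite col_rev; assumption].

Lemma col_neq a b d : col a b d -> [/\ a != b, a != d & b != d].
Proof.
move=> cabd; split; apply/eqP=> e; move: cabd; rewrite e ?(col_irr plane) //.
  by rewrite swap rot (col_irr plane).
by rewrite rot (col_irr plane).
Qed.

Lemma col_blk i j k : col i j k -> (blk i < blk j)%N -> blk k = blk j.
Proof.
move=> cijk ltij; apply/val_inj/eqP; rewrite eqn_leq.
have jki : col j i k by rewrite swap.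
have kij : col k i j by rewrite -col_rot2.
have := col_top plane jki; have := col_top plane kij.
rewrite ltij /= -!leqNgt => + ->; rewrite andbT; apply: contraR; rewrite -ltnNge => lt.
by rewrite lt (ltn_trans ltij lt).
Qed.

Section Line.
Variables (j i k : 'I_n).
Hypotheses (ltij : (blk i < blk j)%N) (ltjk : (blk j < blk k)%N).

(** The line through [i] and [j] without [j]; [i] is added by hand because [col] holds only for
    distinct points. The relation of [(j, i)] sums over these [h]. *)
Definition punctured (j i h : 'I_n) := (h == i) || col i j h.
Notation G := (punctured j i).

Lemma punctured_neq h : G h -> j != h.
Proof.
case/orP=> [/eqP-> | /col_neq[]//]; by apply: contraTneq ltij => ->; rewrite ltnn.
Qed.

Lemma punctured_blk h : G h -> (blk h <= blk j)%N.
Proof. by case/orP=> [/eqP-> | /col_blk->//]; rewrite ltnW. Qed.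

Lemma punctured_ncol h : G h -> col j h k = false.
Proof.
move=> Gh; apply/negP=> cjhk; have: col k j h by rewrite -col_rot2.
by move/(col_top plane); rewrite ltjk (leq_ltn_trans (punctured_blk Gh)).
Qed.

Lemma punctured_close h h' : G h -> col j h h' -> G h'.
Proof.
rewrite /punctured; case/orP=> [/eqP-> | cijh cjhh']; first by rewrite swap => ->; rewrite orbT.
case: eqVneq => //= h'i.
have cjhi : col j h i by colp.
have := ctr cjhi cjhh'; rewrite eq_sym h'i => /(_ isT).
by rewrite swap => ->.
Qed.

(** Two such points would share a line with [k] while both lying in earlier blocks, against
    [col_top]. *)
Lemma punctured_uniq m : {in [pred h | G h && col h k m] &, forall x y, x = y}.
Proof.
move=> x y; rewrite !inE => /andP[Gx cx] /andP[Gy cy]; apply/eqP/negPn/negP => xy.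
have ltk z : G z -> (blk z < blk k)%N by move/punctured_blk/leq_ltn_trans; apply.
have ckmx : col k m x by colp.
have ckmy : col k m y by colp.
have ckxy := ctr ckmx ckmy xy.
by have:= col_top plane ckxy; rewrite !ltk.
Qed.

(** Since [l] and [m] lie in the block of [k], [col_low] gives their line a point [h'] in an earlier
    block, and [col_pasch] places [h'] on the line of [j] and [h]. This completes a quadrilateral
    with one side on [G]. *)
Lemma transversal h l m : G h -> col j k l -> col h k m ->
  exists h', [/\ G h', col h' l m & col j h h'].
Proof.
move=> Gh cjkl chkm; have jh := punctured_neq Gh.
have lthk : (blk h < blk k)%N by rewrite (leq_ltn_trans (punctured_blk Gh)).
have bl := col_blk cjkl ltjk; have bm := col_blk chkm lthk.
have nhkl : ~~ col h k l.
  apply/negP; rewrite rot => chkl; move: cjkl; rewrite rot => cjkl.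
  have := ctr chkl cjkl; rewrite eq_sym => /(_ jh).
  by rewrite col_rev punctured_ncol.
have lm : l != m by apply: contraNneq nhkl => ->.
have [h' [lth' ch']] := col_low plane lm (etrans bl (esym bm)).
have hh' : h != h'.
  apply: contraNneq nhkl => e; move: ch'; rewrite -e => chlm.
  have [_ _ kl] := col_neq cjkl.
  apply: (ctr (b := m)) => //; by rewrite col_swap23.
have cj : col j h h'.
  apply: (col_pasch plane) cjkl chkm ch' jh hh'; rewrite ?bl ?bm //.
  by rewrite -bl.
by exists h'; split=> //; apply: punctured_close cj.
Qed.
End Line.

(** Menelaus is applied twice, based at the vertices [h2] and [h] of the side [j h h2]. The two
    resulting products differ by four transpositions of arguments of [c], which cost [s ^ 4 = 1]. *)
Lemma menelaus_quad j h h2 k l m : col j h h2 -> col j l m -> col h k l -> col h2 k m ->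
  j != k -> ~~ col j h k ->
  c j h * c k h * c k l * c l j = c j h2 * c k h2 * c k m * c m j.
Proof.
move=> cjhh2 cjlm chkl ch2km jk njhk.
have [jh jh2 hh2] := col_neq cjhh2; have [jl jm lm] := col_neq cjlm.
have n1 : ~~ col h2 h k.
  apply: contra njhk => ch2hk.
  have h1 : col h h2 k by colp.
  have h3 : col h h2 j by colp.
  have := ctr h3 h1 jk => ?; colp.
have E1 : c h2 h * c k h * c k l = c h2 j * c m j * c m l.
  apply: (sign_menelaus sgn) => //; colp.
have E2 : c h h2 * c k h2 * c k m = c h j * c l j * c l m.
  apply: (sign_menelaus sgn) => //; colp.
have sq a b : a != b -> c a b * c a b = 1 := @sign_sq _ _ _ _ _ sgn a b.
have sy a b : a != b -> c a b = s * c b a := @sign_sym _ _ _ _ _ sgn a b.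
have F1 : c k h * c k l = c h2 h * c h2 j * c m j * c m l.
  transitivity (c h2 h * c h2 h * (c k h * c k l)).
    by rewrite sq ?mul1r // eq_sym.
  transitivity (c h2 h * (c h2 h * c k h * c k l)); first ring.
  rewrite E1; ring.
have F2 : c k h2 * c k m = c h h2 * c h j * c l j * c l m.
  transitivity (c h h2 * c h h2 * (c k h2 * c k m)); first by rewrite sq ?mul1r.
  transitivity (c h h2 * (c h h2 * c k h2 * c k m)); first ring.
  rewrite E2; ring.
rewrite -[_ * c k h * _]mulrA F1 -[_ * c k h2 * _]mulrA F2.
rewrite (sy h2 h) 1?eq_sym // (sy h2 j) 1?eq_sym // (sy m l) 1?eq_sym // (sy j h) //.
transitivity (s * s * (s * s) * (c h j * c h h2 * c j h2 * c m j * c l m * c l j)).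
  ring.
rewrite ss; ring.
Qed.

(* The second-order part of moving [y_h] and then [y_j] past [y_k], written with the
   double brackets [[y_a, y_b]_s, y_d] whose coefficients are read off by [g]. *)
Definition bracket3 (g : 'I_n -> 'I_n -> 'I_n -> K) a b d :=
  g a b d - s * g b a d - (g d a b - s * g d b a).

(** The inner bracket of [bracket3] is twisted by [s] but the outer one is an ordinary commutator;
    for this mixture the Jacobi identity holds with both signs, as only [s * s = 1] is used. *)
Lemma jacobi g k l m :
  bracket3 g l m k = s * bracket3 g k m l - bracket3 g k l m.
Proof.
rewrite /bracket3.
transitivity (s * (g k m l - s * g m k l - (g l k m - s * g l m k))
  - (g k l m - s * g l k m - (g m k l - s * g m l k)) + (1 - s * s) * (g l m k - g m k l)).
  ring.
by rewrite ss subrr mul0r addr0.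
Qed.

Definition cubic g k j h :=
  \sum_(l | col j k l) c k j * c k l *
     (s * (\sum_(m | col h k m) c k h * c k m * bracket3 g k m l)
      - \sum_(m | col h l m) c l h * c l m * bracket3 g l m k).

(** Three families of terms are left after Jacobi. Those with [l] on [jk] and [m] on [hk] cancel
    against those with [m] on [hl], through the quadrilaterals of [transversal]; the third family is
    antisymmetric in [l] and [m]. *)
Lemma cubic_sum g i j k : (blk i < blk j)%N -> (blk j < blk k)%N ->
  \sum_(h | punctured j i h) c j h * (cubic g k j h - s * cubic g k h j) = 0.
Proof.
move=> ltij ltjk; set G := punctured j i; set B := bracket3 g.
have jk : j != k by apply: contraTneq ltjk => ->; rewrite ltnn.
pose A' j h := \sum_(l | col j k l) \sum_(m | col h k m) c k j * c k l * (c k h * c k m * B l m k).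
pose P j h := \sum_(l | col j k l) \sum_(m | col h l m) c k j * c k l * (c l h * c l m * B l m k).
(* Jacobi fuses the two double sums over a point of [jk] and a point of [hk] into the single sum
   [A'], so that all three families carry the same bracket [B l m k]. *)
have E h : cubic g k j h - s * cubic g k h j = A' j h - P j h + s * P h j.
  pose A j h := \sum_(l | col j k l) \sum_(m | col h k m) c k j * c k l * (c k h * c k m * B k m l).
  have Qe j' h' : cubic g k j' h' = s * A j' h' - P j' h'.
    rewrite /cubic /A /P mulr_sumr -sumrB; apply: eq_bigr => l _.
    by rewrite -!mulr_sumr -/B mulrBr mulrCA.
  rewrite !Qe.
  have -> : A' j h = s * A j h - A h j.
    rewrite /A' /A mulr_sumr [X in _ - X]exchange_big -sumrB /=.
    apply: eq_bigr => l _; rewrite mulr_sumr -sumrB; apply: eq_bigr => m _.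
    rewrite /B jacobi; ring.
  transitivity (s * A j h - P j h - s * s * A h j + s * P h j); first ring.
  rewrite ss; ring.
under eq_bigr => h _ do rewrite E mulrDr mulrBr.
rewrite big_split sumrB /=.
(* For fixed [l] and [m] each side has at most one term: the point of [G] on the line [km],
   respectively on the line [lm]. [transversal] matches the two points and Menelaus matches the
   coefficients. *)
have -> : \sum_(h | G h) c j h * A' j h = \sum_(h | G h) c j h * P j h.
  under eq_bigr => h _ do rewrite mulr_sumr.
  under [RHS]eq_bigr => h _ do rewrite mulr_sumr.
  rewrite exchange_big [RHS]exchange_big /=; apply: eq_bigr => l cjkl.
  under eq_bigr => h _ do rewrite mulr_sumr.
  under [RHS]eq_bigr => h _ do rewrite mulr_sumr.
  rewrite (exchange_big_dep xpredT) // [RHS](exchange_big_dep xpredT) //=.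
  apply: eq_bigr => m _.
  have bl := col_blk cjkl ltjk; have ltjl : (blk j < blk l)%N by rewrite bl.
  transitivity (c k j * c k l * B l m k * \sum_(h | G h && col h k m) c j h * c k h * c k m).
    rewrite mulr_sumr; apply: eq_bigr => h _; ring.
  transitivity (c k j * c k l * B l m k *
    \sum_(h | G h && col h l m) c j h * c l h * c l m); last first.
    rewrite mulr_sumr; apply: eq_bigr => h _; ring.
  congr (_ * _); apply: eq_big_unique.
  - exact: punctured_uniq.
  - exact: punctured_uniq.
  - move=> h /andP[Gh chkm].
    have [h' [Gh' ch' cj]] := transversal ltij ltjk Gh cjkl chkm.
    exists h'; first by apply/andP.
    by apply: (sign_menelaus sgn cj cjkl) => //; rewrite (punctured_ncol ltij ltjk).
  move=> h /andP[Gh chlm].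
  have cjlk : col j l k by colp.
  have [h' [Gh' ch' cj]] := transversal ltij ltjl Gh cjlk chlm.
  by exists h'; apply/andP.
rewrite subrr add0r.
(* [U] is constant on the points [l], [m] of a line through [j] by [menelaus_quad], whereas
   [c l m * B l m k] changes sign when [l] and [m] are exchanged. *)
pose U l := \sum_(h | G h && col h k l) c j h * c k h * c k l * c l j.
have US l m : col j l m -> U l = U m.
  move=> cjlm; apply: eq_big_unique.
  - exact: punctured_uniq.
  - exact: punctured_uniq.
  - move=> h /andP[Gh chkl].
    have lthk : (blk h < blk k)%N by rewrite (leq_ltn_trans (punctured_blk ltij Gh)).
    have bl := col_blk chkl lthk; have ltjl : (blk j < blk l)%N by rewrite bl.
    have chlk : col h l k by colp.
    have [h' [Gh' ch' cj]] := transversal ltij ltjl Gh cjlm chlk.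
    have ch'' : col h' k m by colp.
    exists h'; first by apply/andP.
    by apply: menelaus_quad => //; rewrite (punctured_ncol ltij ltjk).
  move=> h /andP[Gh chkm].
  have lthk : (blk h < blk k)%N by rewrite (leq_ltn_trans (punctured_blk ltij Gh)).
  have bm := col_blk chkm lthk; have ltjm : (blk j < blk m)%N by rewrite bm.
  have chmk : col h m k by colp.
  have cjml : col j m l by colp.
  have [h' [Gh' ch' cj]] := transversal ltij ltjm Gh cjml chmk.
  by exists h'; apply/andP; split=> //; colp.
transitivity (s * \sum_l \sum_m if col j l m then U l * c l m * B l m k else 0).
  transitivity (s * \sum_(h | G h) \sum_(l | col h k l) \sum_(m | col j l m)
      c j h * (c k h * c k l * (c l j * c l m * B l m k))).
    rewrite mulr_sumr; apply: eq_bigr => h _; rewrite mulrCA mulr_sumr.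
    by congr (_ * _); apply: eq_bigr => l _; rewrite mulr_sumr.
  congr (_ * _); rewrite (exchange_big_dep xpredT) //=; apply: eq_bigr => l _.
  rewrite exchange_big [LHS]big_mkcond /=; apply: eq_bigr => m _.
  case: ifP => // cjlm; rewrite /U !mulr_suml; apply: eq_bigr => h _; ring.
rewrite sum_antisym ?mulr0 // => [l|l m].
  by rewrite rot (col_irr plane).
rewrite col_swap23; case: ifP => [cjml|]; last by rewrite oppr0.
have [jm jl ml] := col_neq cjml.
rewrite (US _ _ cjml) (sign_sym sgn ml) /B /bracket3.
transitivity (- (U l * (s * c l m) * (g m l k - s * g l m k - (g k m l - s * g k l m)))
  + (1 - s * s) * (U l * c l m * (g l m k - g k l m))); first ring.
by rewrite ss subrr mul0r addr0.
Qed.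

(* Words are stored in reverse here: [act i f v] is the value of the linear functional [f]
   on the normal form of the product of the normal word [rev v] with the letter [i]. *)
Fixpoint act (i : 'I_n) (f : word n -> K) (v : word n) {struct v} : K :=
  if v is k :: u then
    if (blk k <= blk i)%N then f (i :: k :: u)
    else s * act i (fun x => f (k :: x)) u
         - \sum_(l | col i k l) c k i * c k l * (f (l :: k :: u) - s * f (k :: l :: u))
  else f [:: i].

(** Solving the relation of [(k, i)] for [y_k y_i] gives [s y_i y_k] minus these brackets; the
    factor [c k i] is its own inverse. When [i] is in an earlier block than [k], every [l] is in the
    block of [k], so the new words need no further sorting. *)
Definition der i k (f : word n -> K) u :=
  \sum_(l | col i k l) c k i * c k l * (f (l :: k :: u) - s * f (k :: l :: u)).

Lemma act_cons i f k u : (blk i < blk k)%N ->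
  act i f (k :: u) = s * act i (fun x => f (k :: x)) u - der i k f u.
Proof. by rewrite ltnNge /= => /negbTE->. Qed.

Lemma act_ext i f g v : f =1 g -> act i f v = act i g v.
Proof.
elim: v f g => [|k u IH] f g e /=; first exact: e.
rewrite e (IH _ (fun x => g (k :: x))) // .
by congr (if _ then _ else _ - _); apply: eq_bigr => l _; rewrite !e.
Qed.

Lemma act_lin i a f g v :
  act i (fun x => f x + a * g x) v = act i f v + a * act i g v.
Proof.
elim: v f g => [|k u IH] f g //=.
case: ifP => // _; rewrite IH.
have -> : \sum_(l | col i k l) c k i * c k l * (f (l :: k :: u) + a * g (l :: k :: u)
     - s * (f (k :: l :: u) + a * g (k :: l :: u))) = der i k f u + a * der i k g u.
  by rewrite /der mulr_sumr -big_split; apply: eq_bigr => l _ /=; ring.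
rewrite /der; ring.
Qed.

Lemma act0 i v : act i (fun=> 0) v = 0.
Proof.
elim: v => //= k u ->; case: ifP => // _.
by rewrite big1 ?(mulr0, subr0) // => l _; rewrite !(mulr0, subr0).
Qed.

Lemma act_scale i a f v : act i (fun x => a * f x) v = a * act i f v.
Proof.
rewrite -[RHS]add0r -(act0 i v) -act_lin.
by apply: act_ext => x; rewrite add0r.
Qed.

Lemma act_sub i a f g v : act i (fun x => f x - a * g x) v = act i f v - a * act i g v.
Proof. by rewrite -mulNr -act_lin; apply: act_ext => x; rewrite mulNr. Qed.

Lemma act_sum i (P : pred 'I_n) (F : 'I_n -> word n -> K) v :
  act i (fun x => \sum_(m | P m) F m x) v = \sum_(m | P m) act i (F m) v.
Proof.
rewrite big_mkcond.
transitivity (act i (fun x => \sum_m if P m then F m x else 0) v).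
  by apply: act_ext => x; rewrite big_mkcond.
elim: (index_enum _) => [|m t IH].
  by rewrite big_nil -[RHS](act0 i v); apply: act_ext => x; rewrite big_nil.
rewrite big_cons -IH.
transitivity (act i (fun x => (if P m then F m x else 0)
   + 1 * \sum_(m <- t) (if P m then F m x else 0)) v).
  by apply: act_ext => x; rewrite mul1r big_cons.
rewrite act_lin mul1r; congr (_ + _); case: (P m) => //; by rewrite act0.
Qed.

Arguments act : simpl never.

Lemma act_der i j k f v :
  act i (der j k f) v = \sum_(l | col j k l) c k j * c k l *
     (act i (fun x => f (l :: k :: x)) v - s * act i (fun x => f (k :: l :: x)) v).
Proof. by rewrite act_sum; apply: eq_bigr => l _; rewrite act_scale act_sub. Qed.

(** The arguments of [g] are reversed because words are: [g a b d] reads a word ending in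
    [y_a y_b y_d]. The outer commutator of [bracket3] measures how [der] fails to commute with
    exchanging the order of [y_k] and [y_l]. *)
Lemma bracket_der f k l h u : let g a b d := f (d :: b :: a :: u) in
  \sum_(m | col h k m) c k h * c k m * bracket3 g k m l
  = der h k (fun x => f (l :: x)) u - der h k f (l :: u).
Proof.
rewrite /der -sumrB; apply: eq_bigr => m _; rewrite -mulrBr /bracket3 //.
Qed.

(** Both letters are moved past the last letter [y_k]. The terms split by the number of brackets
    created: none, one, or two, the last ones being [cubic]. *)
Lemma act_act j h f k u : (blk j < blk k)%N -> (blk h < blk k)%N ->
  act j (act h f) (k :: u) = act j (act h (fun x => f (k :: x))) u
    - s * act j (der h k f) u - act h (der j k f) u
    + cubic (fun a b d => f (d :: b :: a :: u)) k j h.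
Proof.
move=> ltjk lthk; rewrite act_cons //.
have -> : act j (fun x => act h f (k :: x)) u =
    s * act j (act h (fun x => f (k :: x))) u - act j (der h k f) u.
  rewrite -act_scale -[X in _ - X]mul1r -act_sub.
  by apply: act_ext => x; rewrite act_cons // mul1r.
rewrite mulrBr mulrA ss mul1r -!addrA; congr (_ + (_ + _)).
rewrite act_der /cubic {1}/der -!sumrN -big_split /=.
apply: eq_bigr => l cjkl.
have bl := col_blk cjkl ltjk.
rewrite !bracket_der !act_cons ?bl //.
set A := act _ _ _; set B := act _ _ _.
set D1 := der _ _ _ _; set D2 := der _ _ _ _; set D3 := der _ _ _ _; set D4 := der _ _ _ _.
transitivity (c k j * c k l *
  (- (s * s * A - s * D1 - D2 - s * (s * s * B) + s * s * D3 + s * D4))).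
  ring.
rewrite ss; ring.
Qed.

Definition head_le (b : 'I_r) (v : word n) := if v is k :: _ then (blk k <= b)%N else true.

Lemma act_low j f v : head_le (blk j) v -> act j f v = f (j :: v).
Proof. by case: v => //= k u; rewrite /act /= => ->. Qed.

(** Moving [y_i] leftwards leaves a last letter of block at most [b], so only such words are read.
    This lets [act j f] be replaced by plain appending of [j] under another [act]. *)
Lemma act_eq_low i f g v (b : 'I_r) : (blk i <= b)%N -> head_le b v ->
  (forall x, head_le b x -> f x = g x) -> act i f v = act i g v.
Proof.
move=> lib; case: v => [|k u] /= lkb e; first exact: e.
have [lki | lik] := leqP (blk k) (blk i); first by rewrite !act_low ?e.
rewrite !act_cons //; congr (_ * _ - _).
  by apply: act_ext => x; apply: e.
by apply: eq_bigr => l /col_blk-/(_ lik) bl; rewrite !e //= bl.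
Qed.

(** Here [y_j] can be appended without moving, so the term of [h = i] unfolds to [- der i j f v];
    the other [h] are in the block of [j] and their brackets add up to the same sum. *)
Lemma act_rel_low j i f v : (blk i < blk j)%N -> head_le (blk j) v ->
  \sum_(h | punctured j i h) c j h * (act j (act h f) v - s * act h (act j f) v) = 0.
Proof.
move=> ltij hv; have Gi : punctured j i i by rewrite /punctured eqxx.
have ij : i != j by apply: contraTneq ltij => ->; rewrite ltnn.
rewrite (bigD1 i) //= (act_low (act i f) hv) (act_cons f v ltij).
have -> : act i (act j f) v = act i (fun x => f (j :: x)) v.
  by apply: (act_eq_low (b := blk j)) => //; [exact: ltnW | move=> x; exact: act_low].
rewrite addrAC subrr add0r mulrN /der mulr_sumr addrC.
apply/eqP; rewrite subr_eq0; apply/eqP.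
apply: eq_big => [h | h /andP[Gh hi]].
  rewrite /punctured; case: eqVneq => [->|_]; rewrite ?andbT //=.
  by rewrite col_swap23 (col_irr plane).
have bh : blk h = blk j.
  by move: Gh; rewrite /punctured (negbTE hi) => /col_blk-/(_ ltij).
have hv' : head_le (blk h) v by rewrite bh.
rewrite (act_low (act h f) hv) (act_low (act j f) hv').
rewrite !act_low /= ?bh //.
by rewrite !mulrA (sign_sq sgn) ?mul1r // eq_sym.
Qed.

(** Last letters [y_k] above [j] are stripped one by one. The terms of [act_act] with a single [der]
    cancel for each [h] separately, by [s * s = 1]; the [cubic] terms cancel only after summing over
    the line. *)
Lemma act_rel j i f v : (blk i < blk j)%N ->
  \sum_(h | punctured j i h) c j h * (act j (act h f) v - s * act h (act j f) v) = 0.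
Proof.
move=> ltij; elim: v f => [|k u IH] f; last first.
  have [lkj | ltjk] := leqP (blk k) (blk j); last first.
    have ltk h : punctured j i h -> (blk h < blk k)%N.
      by move/(punctured_blk ltij)/leq_ltn_trans; apply.
    transitivity (\sum_(h | punctured j i h) (c j h * (act j (act h (fun x => f (k :: x))) u
       - s * act h (act j (fun x => f (k :: x))) u)
       + c j h * (cubic (fun a b d => f (d :: b :: a :: u)) k j h
           - s * cubic (fun a b d => f (d :: b :: a :: u)) k h j))).
      apply: eq_bigr => h Gh; rewrite !act_act ?(ltk h) //.
      set X := act h (der j k f) u; set Y := act j (der h k f) u.
      rewrite -mulrDr; congr (_ * _).
      transitivity (act j (act h (fun x => f (k :: x))) u
        - s * act h (act j (fun x => f (k :: x))) u - X + s * s * X +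
        (cubic (fun a b d => f (d :: b :: a :: u)) k j h
           - s * cubic (fun a b d => f (d :: b :: a :: u)) k h j)); first ring.
      by rewrite ss mul1r subrK.
    by rewrite big_split /= IH cubic_sum // addr0.
  exact: act_rel_low.
exact: act_rel_low.
Qed.
End NormalForm.

(** * The monomial order *)

Section MonomialOrder.
Variables (n r : nat) (blk : 'I_n -> 'I_r).
Local Open Scope nat_scope.

(** Letters are compared by block; the index, being less than [n], only breaks ties, which makes the
    order total. *)
Definition key (i : 'I_n) := blk i * n + i.
Definition weight (w : word n) := \sum_(i <- w) blk i.

Fixpoint lexlt (u v : word n) := match u, v with
  | x :: u', y :: v' => (key x < key y) || (x == y) && lexlt u' v'
  | _, _ => false
  end.

(* Among words of equal length the heavier one is smaller: this makes [y_j y_i] beat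
   the terms [y_j y_k] and [y_k y_j] with [k] in the block of [j]. *)
Definition word_lt : rel (word n) := fun u v =>
  (size u < size v) || (size u == size v) &&
    ((weight v < weight u) || (weight u == weight v) && lexlt u v).

Lemma key_lt i j : blk i < blk j -> key i < key j.
Proof. by rewrite /key; have := ltn_ord i; nia. Qed.

Lemma key_inj : injective key.
Proof.
move=> i j e; have [lt|lt|eqb] := ltngtP (blk i) (blk j).
- by have := key_lt lt; rewrite e ltnn.
- by have := key_lt lt; rewrite e ltnn.
by move: e; rewrite /key eqb => /addnI/val_inj.
Qed.

Lemma lexlt_irr : irreflexive lexlt.
Proof. by elim=> //= x u ->; rewrite ltnn andbF. Qed.

Lemma lexlt_trans : transitive lexlt.
Proof.
elim=> [|y v IH] [|x u] [|z w] //= /orP[xy | /andP[/eqP-> uv]] /orP[yz | /andP[/eqP<- vw]].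
- by rewrite (ltn_trans xy yz).
- by rewrite xy.
- by rewrite yz.
- by rewrite eqxx (IH _ _ uv vw) orbT.
Qed.

Lemma lexlt_total u v : size u = size v -> u != v -> lexlt u v || lexlt v u.
Proof.
elim: u v => [|x u IH] [|y v] //= [/IH{}IH]; rewrite eqseq_cons [y == x]eq_sym.
case: eqVneq => [->|xy _] /=; first by move/IH; rewrite ltnn.
by rewrite !orbF; case: ltngtP => // /key_inj e; rewrite e eqxx in xy.
Qed.

Lemma lexlt_cat2l a u v : lexlt (a ++ u) (a ++ v) = lexlt u v.
Proof. by elim: a => //= x a ->; rewrite ltnn eqxx. Qed.

Lemma lexlt_catr b u v : size u = size v -> lexlt u v -> lexlt (u ++ b) (v ++ b).
Proof.
elim: u v => [|x u IH] [|y v] //= [/IH{}IH] /orP[->//|/andP[-> /IH->]].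
by rewrite orbT.
Qed.

Lemma weight_cat u v : weight (u ++ v) = weight u + weight v.
Proof. by rewrite /weight big_cat. Qed.

Lemma word_lt_irr : irreflexive word_lt.
Proof. by move=> u; rewrite /word_lt !ltnn lexlt_irr !andbF. Qed.

Lemma word_lt_trans : transitive word_lt.
Proof.
move=> v u w; rewrite /word_lt.
case/orP=> [uv|/andP[/eqP-> H1]] /orP[vw|/andP[/eqP<- H2]].
- by rewrite (ltn_trans uv vw).
- by rewrite uv.
- by rewrite vw.
rewrite eqxx; apply/orP; right => /=; move: H1 H2.
case/orP=> [uv|/andP[/eqP-> H1]] /orP[vw|/andP[/eqP<- H2]].
- by rewrite (ltn_trans vw uv).
- by rewrite uv.
- by rewrite vw.
by rewrite eqxx (lexlt_trans H1 H2) orbT.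
Qed.

(** Reversing the weight does no harm since there are finitely many words of each length: the
    induction is on the length and then on the number of words of that length below. *)
Lemma word_lt_wf : well_founded (fun u v => word_lt u v).
Proof.
pose below d (w : word n) := #|[set t : d.-tuple 'I_n | word_lt t w]|.
suff H d : forall w, size w = d -> Acc (fun u v => word_lt u v) w by move=> w; apply: (H (size w)).
elim/ltn_ind: d => d IHd w; move: {2}(below d w) (leqnn (below d w)) => m.
elim/ltn_ind: m w => m IHm w le_m sw; constructor => u uw.
have := uw; rewrite {1}/word_lt => /orP[lt|/andP[/eqP su _]].
  by apply: (IHd (size u)); rewrite -?sw.
rewrite sw in su; apply: (IHm (below d u)) => //.
apply: leq_trans le_m; apply/proper_card/properP; split.
  by apply/subsetP => t; rewrite !inE => /word_lt_trans; apply.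
by exists (tcast su (in_tuple u)); rewrite !inE val_tcast //= word_lt_irr.
Qed.

Lemma word_lt_order : monomial_order word_lt.
Proof.
split.
- exact: word_lt_irr.
- exact: word_lt_trans.
- move=> u v uv; rewrite /word_lt [size v == _]eq_sym [weight v == _]eq_sym.
  case: ltngtP => //= su; case: ltngtP => //= _.
  by rewrite lexlt_total.
- exact: word_lt_wf.
move=> a b u v; rewrite /word_lt !size_cat !weight_cat.
rewrite ltn_add2l ltn_add2r eqn_add2l eqn_add2r.
case: ltngtP => //= su.
rewrite ltn_add2l ltn_add2r eqn_add2l eqn_add2r.
case: ltngtP => //= _; rewrite lexlt_cat2l; exact: lexlt_catr.
Qed.

Lemma word_lt_swap i j : blk i < blk j -> word_lt [:: i; j] [:: j; i].
Proof.
move=> lt; rewrite /word_lt /weight !big_cons !big_nil /= !addn0 key_lt //.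
by rewrite addnC eqxx orbT.
Qed.

Lemma word_lt_heavy i j k : blk i < blk j -> blk k = blk j ->
  word_lt [:: j; k] [:: j; i] /\ word_lt [:: k; j] [:: j; i].
Proof.
move=> lt e; rewrite /word_lt /weight !big_cons !big_nil /= !addn0 e.
by rewrite ltn_add2l lt.
Qed.

Definition word_le u v := (u == v) || word_lt u v.

Lemma word_le_trans : transitive word_le.
Proof.
move=> v u w /orP[/eqP->//|uv] /orP[/eqP<-|vw]; apply/orP; right=> //.
exact: word_lt_trans vw.
Qed.

Lemma word_le_cat a b u v : word_le u v -> word_le (a ++ u ++ b) (a ++ v ++ b).
Proof.
case/orP=> [/eqP->|uv]; rewrite /word_le ?eqxx //; apply/orP; right.
by case: word_lt_order => _ _ _ _; apply.
Qed.
End MonomialOrder.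

(** * Normal forms read through linear functionals *)

Section Functional.
Variables (K : fieldType) (n r : nat) (blk : 'I_n -> 'I_r).
Variables (col : 'I_n -> 'I_n -> 'I_n -> bool) (s : K) (c : 'I_n -> 'I_n -> K).
Hypothesis plane : plane_axioms blk col.
Hypothesis sgn : sign_axioms col s c.
Notation act := (act blk col s c).
Notation le := (word_le blk).

Definition sorted_word (w : word n) := sorted leq (map (fun i => nat_of_ord (blk i)) w).

(* [nf f w] is the value of [f] on the normal form of [w]. *)
Definition nf (f : word n -> K) w := foldr act (fun x => f (rev x)) w [::].

Lemma foldr_act_ext F G w v : F =1 G -> foldr act F w v = foldr act G w v.
Proof.
move=> e; elim: w v => [|i w IH] v /=; first exact: e.
exact: act_ext.
Qed.

Lemma foldr_act0 w v : foldr act (fun=> 0) w v = 0.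
Proof.
elim: w v => //= i w IH v; rewrite -[RHS](act0 blk col s c i v).
exact: act_ext.
Qed.

Lemma foldr_act_sum (P : pred 'I_n) (a : 'I_n -> K) X Y w v :
  \sum_(h | P h) a h * (foldr act (X h) w v - s * foldr act (Y h) w v)
  = foldr act (fun x => \sum_(h | P h) a h * (X h x - s * Y h x)) w v.
Proof.
elim: w v => //= i w IH v; rewrite -(act_ext _ _ _ _ _ _ IH) act_sum.
by apply: eq_bigr => h _; rewrite act_scale act_sub.
Qed.

(** The suffix [b] is absorbed into the functional to which [act_rel] applies; the prefix [a] then
    acts on the zero functional. *)
Lemma nf_rel f a b i j : (blk i < blk j)%N ->
  \sum_(h | punctured col j i h) c j h *
    (nf f (a ++ [:: j; h] ++ b) - s * nf f (a ++ [:: h; j] ++ b)) = 0.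
Proof.
move=> ltij; rewrite /nf.
under eq_bigr => h _ do rewrite !foldr_cat.
rewrite (foldr_act_sum _ _ (fun h => foldr act (foldr act (fun x => f (rev x)) b) [:: j; h])
   (fun h => foldr act (foldr act (fun x => f (rev x)) b) [:: h; j])).
rewrite -[RHS](foldr_act0 a [::]); apply: foldr_act_ext => x.
exact: act_rel.
Qed.

Lemma nf_sorted f w : sorted_word w -> nf f w = f w.
Proof.
rewrite /nf; set F := fun x => f (rev x).
suff H v : sorted_word (rev v ++ w) -> foldr act F w v = f (rev v ++ w) by move/(H [::])->.
elim: w v => [|i w IH] v sv; first by rewrite /= cats0.
rewrite -cat_rcons -rev_cons /= in IH sv *.
rewrite act_low ?IH //.
case: v sv {IH} => //= k v; rewrite !rev_cons !cat_rcons /sorted_word map_cat.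
by case/cat_sorted2 => _ /= /andP[].
Qed.

(** Triangularity of the action: both the swap and the bracket terms replace the last two letters by
    a smaller pair, so no word above [rcons (rev v) i] is ever read. *)
Lemma act_zero i F v : (forall x, le (rev x) (rcons (rev v) i) -> F x = 0) -> act i F v = 0.
Proof.
elim: v F => [|k u IH] F F0.
  by apply: F0; rewrite -rev_cons /word_le eqxx.
have [lki|lik] := leqP (blk k) (blk i).
  by rewrite act_low //; apply: F0; rewrite -rev_cons /word_le eqxx.
have le2 p q p' q' : word_lt blk [:: p; q] [:: p'; q'] ->
    le (rcons (rcons (rev u) p) q) (rcons (rcons (rev u) p') q').
  move=> lt; rewrite -!cats1 -!catA /=.
  have := @word_le_cat _ _ blk (rev u) [::] [:: p; q] [:: p'; q'].
  by rewrite !cats0 /word_le lt orbT; apply.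
rewrite act_cons // IH ?mulr0 ?sub0r => [|x lex]; last first.
  apply: F0; rewrite !rev_cons; apply: word_le_trans (le2 _ _ _ _ (word_lt_swap lik)).
  by have := @word_le_cat _ _ blk [::] [:: k] _ _ lex; rewrite /= !cats1.
rewrite /der big1 ?oppr0 // => l /(col_blk plane)-/(_ lik) bl.
have [H1 H2] := word_lt_heavy lik bl.
by rewrite !F0 ?mulr0 ?subr0 ?mulr0 // !rev_cons; apply: le2.
Qed.

Lemma nf_low f w : (forall x, le x w -> f x = 0) -> nf f w = 0.
Proof.
rewrite /nf; set F := fun x => f (rev x) => f0.
suff H v : (forall x, le x (rev v ++ w) -> f x = 0) -> foldr act F w v = 0 by apply: H.
elim: w v {f0} => [|i w IH] v f0; first by apply: f0; rewrite cats0 /word_le eqxx.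
apply: act_zero => x lex; apply: IH => y ley; apply: f0.
apply: word_le_trans ley _; rewrite -cat_rcons.
by rewrite -[X in le X]cat0s -[X in le _ X]cat0s; apply: word_le_cat.
Qed.
End Functional.

(** * Ideals of noncommutative polynomials *)

Lemma sum_delta (K : pzRingType) (T : eqType) (t : seq T) u (F : T -> K) :
  uniq t -> u \in t -> \sum_(w <- t) (w == u)%:R * F w = F u.
Proof.
move=> ut ui; rewrite (bigD1_seq u) //= eqxx mul1r big1 ?addr0 // => w /negbTE->.
by rewrite mul0r.
Qed.

Lemma sum_delta_fin (K : pzRingType) (T : finType) u (F : T -> K) :
  \sum_w (w == u)%:R * F w = F u.
Proof. by rewrite (bigD1 u) //= eqxx mul1r big1 ?addr0 // => w /negbTE->; rewrite mul0r. Qed.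

Lemma sum_support (K : nmodType) (T : eqType) (t t' : seq T) (F : T -> K) :
  uniq t -> uniq t' -> (forall w, F w != 0 -> w \in t) -> (forall w, F w != 0 -> w \in t') ->
  \sum_(w <- t) F w = \sum_(w <- t') F w.
Proof.
move=> ut ut' it it'.
have E u : \sum_(w <- u) F w = \sum_(w <- [seq w <- u | F w != 0]) F w.
  rewrite big_filter [RHS]big_mkcond; apply: eq_bigr => w _.
  by case: eqVneq.
rewrite E [RHS]E; apply/perm_big/uniq_perm; rewrite ?filter_uniq // => w.
rewrite !mem_filter; case: (boolP (F w != 0)) => //= w0.
by rewrite it ?it'.
Qed.

Section Ideals.
Variables (K : fieldType) (n : nat).
Implicit Types (p q g : ncpoly K n) (G : ncpoly K n -> Prop).

Lemma shift_cat a g b u : shift a g b (a ++ u ++ b) = g u.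
Proof.
rewrite /shift !size_cat take_size_cat // eqxx.
have -> : (size a + size b <= size a + (size u + size b))%N by lia.
have -> : (size a + (size u + size b) - size a - size b = size u)%N by lia.
have -> : (size a + (size u + size b) - size b = size (a ++ u))%N by rewrite size_cat; lia.
rewrite catA drop_size_cat // eqxx -catA drop_size_cat //.
by rewrite take_size_cat.
Qed.

Lemma shift_supp a g b w : shift a g b w != 0 -> exists2 u, w = a ++ u ++ b & g u != 0.
Proof.
rewrite /shift; case: ifP => [/and3P[le /eqP ea /eqP eb] h|]; last by rewrite eqxx.
exists (take (size w - size a - size b) (drop (size a) w)) => //.
rewrite -{1}(cat_take_drop (size a) w) ea; congr (_ ++ _).
rewrite -{1}(cat_take_drop (size w - size a - size b) (drop (size a) w)); congr (_ ++ _).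
by rewrite drop_drop -[RHS]eb; congr drop; lia.
Qed.

Lemma shift_homog2 a g b w : homog2 g ->
  shift a g b w = \sum_(x : 'I_n * 'I_n) g [:: x.1; x.2] * (w == a ++ [:: x.1; x.2] ++ b)%:R.
Proof.
move=> hg; case: (eqVneq (shift a g b w) 0) => [e|].
  rewrite e big1 // => x _; case: eqVneq => [ew|_]; last by rewrite mulr0.
  by move: e; rewrite ew shift_cat => ->; rewrite mul0r.
case/shift_supp => u -> gu; have := hg _ gu; case: u gu => [|y [|z []]] //= gu _.
rewrite -[[:: y, z & b]]/([:: y; z] ++ b) shift_cat (bigD1 (y, z)) //= eqxx mulr1.
rewrite big1 ?addr0 // => -[y' z'] /= ne.
case: eqP => [/eqP|_]; last by rewrite mulr0.
rewrite eqseq_cat // eqxx /= !eqseq_cons => /and3P[/eqP ey /eqP ez _].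
by rewrite ey ez eqxx in ne.
Qed.

Lemma shift_mono (a u b w : word n) : shift a (mono K u) b w = mono K (a ++ u ++ b) w.
Proof.
rewrite /mono; case: eqVneq => [->|ne]; first by rewrite shift_cat eqxx.
apply/eqP; apply: contraNT ne => /shift_supp[v -> h].
by case: (eqVneq v u) h => [->//|_]; rewrite eqxx.
Qed.

Lemma ideal_ext G p q : p =1 q -> ideal G p -> ideal G q.
Proof.
by move=> e [m [c [a [b [g [Gg E]]]]]]; exists m, c, a, b, g; split=> // w; rewrite -e.
Qed.

Lemma ideal_gen G g a b : G g -> ideal G (shift a g b).
Proof.
move=> Gg; exists 1%N, (fun=> 1), (fun=> a), (fun=> b), (fun=> g); split=> // w.
by rewrite big_ord1 mul1r.
Qed.

Lemma ideal0 G : ideal G (fun=> 0).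
Proof.
exists 0%N, (fun=> 0), (fun=> [::]), (fun=> [::]), (fun=> fun=> 0).
by split=> [[]//|w]; rewrite big_ord0.
Qed.

Lemma ideal_lin G x p q : ideal G p -> ideal G q -> ideal G (fun w => p w + x * q w).
Proof.
move=> [m [c [a [b [g [Gg E]]]]]] [m' [c' [a' [b' [g' [Gg' E']]]]]].
pose pick T (f : 'I_m -> T) (f' : 'I_m' -> T) k :=
  match split k with inl i => f i | inr i => f' i end.
exists (m + m')%N, (pick _ c (fun i => x * c' i)), (pick _ a a'), (pick _ b b'), (pick _ g g').
split=> [k|w]; first by rewrite /pick; case: (split k).
rewrite E E' mulr_sumr big_split_ord /=; congr (_ + _); apply: eq_bigr => i _.
  by rewrite /pick (unsplitK (inl i : 'I_m + 'I_m')).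
by rewrite /pick (unsplitK (inr i : 'I_m + 'I_m')) mulrA.
Qed.

Lemma ideal_sum G (I : Type) (t : seq I) (x : I -> K) (P : I -> ncpoly K n) :
  (forall i, ideal G (P i)) -> ideal G (fun w => \sum_(i <- t) x i * P i w).
Proof.
move=> GP; elim: t => [|i t IH].
  by apply: ideal_ext (ideal0 G) => w; rewrite big_nil.
apply: ideal_ext (ideal_lin (x i) IH (GP i)) => w.
by rewrite big_cons addrC.
Qed.

Lemma ideal_trans G G' p :
  (forall g a b, G g -> ideal G' (shift a g b)) -> ideal G p -> ideal G' p.
Proof.
move=> GG' [m [c [a [b [g [Gg E]]]]]].
apply: (@ideal_ext _ (fun w => \sum_i c i * shift (a i) (g i) (b i) w)) => [w|].
  by rewrite E.
by apply: ideal_sum => i; apply: GG'.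
Qed.

(** This is how a functional on words descends to the quotient: it suffices to test it on the
    two-sided multiples of quadratic generators. The list [t] stands for any finite set containing
    the support. *)
Lemma ideal_pair G (E : word n -> K) p t :
  (forall g, G g -> homog2 g) ->
  (forall a b g, G g ->
     \sum_(x : 'I_n * 'I_n) g [:: x.1; x.2] * E (a ++ [:: x.1; x.2] ++ b) = 0) ->
  ideal G p -> uniq t -> (forall w, p w != 0 -> w \in t) ->
  \sum_(w <- t) p w * E w = 0.
Proof.
move=> hG GE [m [c [a [b [g [Gg Ep]]]]]] ut pt.
pose W := [seq a x.1 ++ [:: x.2.1; x.2.2] ++ b x.1 | x : 'I_m * ('I_n * 'I_n)].
(* Words that cancel in [p] still occur in the chosen expression of [p]; the list must contain them
   before the two sums are exchanged. *)
rewrite (@sum_support _ _ t (undup (t ++ W))) ?undup_uniq //; first last.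
- move=> w pw; rewrite mem_undup mem_cat pt //; apply: contraNneq pw => ->.
  by rewrite mul0r.
- move=> w pw; rewrite pt //; apply: contraNneq pw => ->.
  by rewrite mul0r.
under eq_bigr => w _ do rewrite Ep mulr_suml.
rewrite exchange_big big1 //= => i _.
under eq_bigr => w _ do rewrite -mulrA.
rewrite -mulr_sumr; under eq_bigr => w _ do rewrite (shift_homog2 _ _ _ (hG _ (Gg i))) mulr_suml.
rewrite exchange_big; apply/eqP; rewrite mulf_eq0; apply/orP; right; apply/eqP.
rewrite -[RHS](GE (a i) (b i) _ (Gg i)) /=; apply: eq_bigr => x _.
under eq_bigr => w _ do rewrite -mulrA.
rewrite -mulr_sumr sum_delta ?undup_uniq // mem_undup mem_cat; apply/orP; right.
by apply/codomP; exists (i, x).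
Qed.
End Ideals.

(** * Groebner bases of the dual ideal *)

Section Descents.
Variables (n r : nat) (blk : 'I_n -> 'I_r).

Lemma descentP (w : word n) : ~~ sorted_word blk w ->
  exists a j i b, w = a ++ [:: j; i] ++ b /\ (blk i < blk j)%N.
Proof.
rewrite /sorted_word; case: w => //= x w; elim: w x => //= y w IH x.
rewrite negb_and -ltnNge; case/orP=> [lt|/IH[a [j [i [b [-> lt]]]]]].
  by exists [::], x, y, w.
by exists (x :: a), j, i, b.
Qed.

Lemma sorted_word_infix (w u : word n) : infix u w -> sorted_word blk w -> sorted_word blk u.
Proof.
case/infixP => [a [b ->]]; rewrite /sorted_word !map_cat.
by case/cat_sorted2 => _ /cat_sorted2[].
Qed.

End Descents.

Section Quadratic.
Variables (K : fieldType) (n r : nat) (blk : 'I_n -> 'I_r).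
Variables (col : 'I_n -> 'I_n -> 'I_n -> bool) (s : K) (c : 'I_n -> 'I_n -> K).
Hypothesis plane : plane_axioms blk col.
Hypothesis sgn : sign_axioms col s c.
Notation ord := (word_lt blk).

(* Orthogonality to the quadratic relations, read on coefficients: after rescaling by [c]
   the last condition says that [q] is a cocycle on each line. *)
Definition dual_form (q : 'I_n -> 'I_n -> K) :=
  [/\ forall a, q a a = 0, forall a b, q a b = - s * q b a &
      forall x y z, col x y z -> c x y * q x y + c y z * q y z + c z x * q z x = 0].

Variable D : ncpoly K n -> Prop.
Hypothesis DP : forall q, D q <-> homog2 q /\ dual_form (fun a b => q [:: a; b]).
Notation J := (ideal D).

Definition line_rel (P : pred 'I_n) j : ncpoly K n :=
  fun w => \sum_(h | P h) c j h * ((w == [:: j; h])%:R - s * (w == [:: h; j])%:R).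

(** The factor [c j i], a square root of one, normalises the coefficient of [y_j y_i] to one. *)
Definition retro_rel j i : ncpoly K n :=
  fun w => c j i * line_rel (punctured col j i) j w.

Lemma line_relE P j a b : line_rel P j [:: a; b] =
  (a == j)%:R * (P b)%:R * c j b - s * (b == j)%:R * (P a)%:R * c j a.
Proof.
rewrite /line_rel big_mkcond.
transitivity (\sum_h (h == b)%:R * ((a == j)%:R * (P h)%:R * c j h)
   - \sum_h (h == a)%:R * (s * (b == j)%:R * (P h)%:R * c j h)); last first.
  by rewrite !sum_delta_fin.
rewrite -sumrB; apply: eq_bigr => h _; rewrite !eqseq_cons !andbT.
rewrite [b == h]eq_sym [a == h]eq_sym; case: (P h); last by rewrite !(mulr0, mul0r) subrr.
by rewrite -!mulnb !natrM /= mulr1n; ring.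
Qed.

Lemma line_rel_homog2 P j : homog2 (line_rel P j).
Proof.
move=> w; case: (eqVneq (size w) 2%N) => // w2; rewrite /line_rel big1 ?eqxx // => h _.
case: (eqVneq w [:: j; h]) w2 => [->//|_]; case: (eqVneq w [:: h; j]) => [->//|_] _.
by rewrite mulr0 subrr mulr0.
Qed.

(** After multiplication by [c] the coefficients take the values 0, 1 and -1 and are antisymmetric.
    On a line through [j] the predicate [P] is constant away from [j], so the two terms involving
    [j] cancel. *)
Lemma line_rel_dual (P : pred 'I_n) j : (forall h, P h -> h != j) ->
  (forall y z, col j y z -> P y = P z) -> dual_form (fun a b => line_rel P j [:: a; b]).
Proof.
move=> Pj Pcol; have Pjj : P j = false by apply/negP => /Pj; rewrite eqxx.
have c2 : forall a, P a -> c j a * c j a = 1.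
  by move=> a /Pj; rewrite eq_sym => /(sign_sq sgn).
have Q a b : a != b -> c a b * line_rel P j [:: a; b] = ((a == j) && P b)%:R - ((b == j) && P a)%:R.
  move=> ab; rewrite line_relE -!mulnb !natrM.
  case: (eqVneq a j) ab => [->|aj] ab.
    rewrite eq_sym (negbTE ab) !(mul0r, mulr0, subr0, mul1r).
    by case: (boolP (P b)) => [/c2|]; rewrite !(mul0r, mulr0, mul1r).
  case: (eqVneq b j) ab => [->|bj] ab; last by rewrite !(mul0r, mulr0, subrr).
  rewrite !(mul0r, mulr0, sub0r, mul1r, mulr1) (sign_sym sgn ab).
  case: (boolP (P a)) => [/c2 e|_]; last by rewrite !(mul0r, mulr0, oppr0).
  rewrite /= ?mulr1n; transitivity (- (s * s * (c j a * c j a))); first ring.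
  by rewrite e (sign_ss sgn) mul1r.
split.
- move=> a; rewrite line_relE; case: eqVneq => [->|_]; last by rewrite !(mul0r,mulr0) subrr.
  by rewrite Pjj !(mul0r,mulr0) subrr.
- move=> a b; rewrite !line_relE.
  transitivity (s * s * ((a == j)%:R * (P b)%:R * c j b) - s * (b == j)%:R * (P a)%:R * c j a).
    by rewrite (sign_ss sgn) mul1r.
  ring.
move=> x y z cxyz; have [xy xz yz] := col_neq plane cxyz.
rewrite !Q // 1?eq_sym //.
case: (eqVneq x j) xy xz cxyz => [->|xj] xy xz cxyz.
  rewrite !(eq_sym _ j) (negbTE xy) (negbTE xz) /= (Pcol _ _ cxyz).
  by rewrite !subr0 sub0r addr0 subrr.
case: (eqVneq y j) yz cxyz {xy} => [->|yj] yz cxyz.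
  rewrite [z == j]eq_sym (negbTE yz) /=.
  have cyzx : col j z x by rewrite (col_rot2 plane).
  by rewrite (Pcol _ _ cyzx) !(mulr0n, subr0, sub0r, addr0) addNr.
case: (eqVneq z j) cxyz {xz yz} => [->|zj] cxyz; last by rewrite subrr !addr0.
have czxy : col j x y by rewrite (col_rot plane).
by rewrite (Pcol _ _ czxy) /= !(mulr0n, subr0, sub0r, add0r) addNr.
Qed.

Lemma dual_form_sum (I : finType) (P : pred I) (x : I -> K) (q : I -> 'I_n -> 'I_n -> K) :
  (forall i, P i -> dual_form (q i)) -> dual_form (fun a b => \sum_(i | P i) x i * q i a b).
Proof.
move=> Hq; split.
- by move=> a; rewrite big1 // => i /Hq[-> _ _]; rewrite mulr0.
- by move=> a b; rewrite mulr_sumr; apply: eq_bigr => i /Hq[_ -> _]; rewrite mulrCA.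
move=> a b d cabd; rewrite !mulr_sumr -!big_split big1 //= => i /Hq[_ _ /(_ _ _ _ cabd) e].
transitivity (x i * (c a b * q i a b + c b d * q i b d + c d a * q i d a)); first ring.
by rewrite e mulr0.
Qed.

Lemma dual_form_sub q q' : dual_form q -> dual_form q' -> dual_form (fun a b => q a b - q' a b).
Proof.
move=> [h1 h2 h3] [h1' h2' h3']; split.
- by move=> a; rewrite h1 h1' subrr.
- by move=> a b; rewrite h2 h2'; ring.
move=> x y z cxyz; rewrite -[RHS](subrr 0) -{1}(h3 x y z cxyz) -(h3' x y z cxyz); ring.
Qed.

(** For two letters of one block, [col_low] supplies a point of an earlier block on their line, and
    the cocycle condition expresses their coefficient by retrograde ones. *)
Lemma dual_form_eq0 q : dual_form q ->
  (forall j i, (blk i < blk j)%N -> q j i = 0) -> forall a b, q a b = 0.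
Proof.
move=> [h1 h2 h3] h a b; have h' i j : (blk i < blk j)%N -> q i j = 0.
  by move=> lt; rewrite h2 h ?mulr0.
have [lt|lt|e] := ltngtP (blk a) (blk b); [exact: h'|exact: h|].
have [->|ab] := eqVneq a b; first exact: h1.
have [i [lti ciab]] := col_low plane ab (val_inj e).
have := h3 _ _ _ ciab; rewrite (h' i a) // (h b i) -?e // !mulr0 add0r addr0 => e0.
by rewrite -[LHS]mul1r -(sign_sq sgn ab) -mulrA e0 mulr0.
Qed.

Lemma punctured_irr j i : (blk i < blk j)%N -> forall h, punctured col j i h -> h != j.
Proof. by move=> lt h /(punctured_neq plane lt); rewrite eq_sym. Qed.

Lemma punctured_line j i y z : col j y z -> punctured col j i y = punctured col j i z.
Proof.
have H y' z' : col j y' z' -> punctured col j i y' -> punctured col j i z'.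
  by move=> cc Gy; apply: (punctured_close plane Gy).
move=> cjyz; apply/idP/idP; first exact: H.
by apply: H; rewrite (col_swap23 plane).
Qed.

Lemma retro_rel_dual j i : (blk i < blk j)%N -> D (retro_rel j i).
Proof.
move=> lt; apply/DP; split.
  by move=> w; rewrite mulf_eq0 negb_or => /andP[_ /line_rel_homog2].
have := line_rel_dual (punctured_irr lt) (@punctured_line j i).
case=> h1 h2 h3; split.
- by move=> a; rewrite /retro_rel h1 mulr0.
- by move=> a b; rewrite /retro_rel h2 mulrCA.
move=> x y z /h3 e; rewrite /retro_rel -[RHS](mulr0 (c j i)) -{1}e; ring.
Qed.

(** The relations are biorthogonal to the retrograde pairs, which yields at once the expansion of
    every dual form and the reducedness of the basis. *)
Lemma retro_relE j i a b : (blk i < blk j)%N -> (blk b < blk a)%N ->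
  retro_rel j i [:: a; b] = ((a == j) && (b == i))%:R.
Proof.
move=> lt ltba; rewrite /retro_rel line_relE -mulnb natrM.
have ij : i != j by apply: contraTneq lt => ->; rewrite ltnn.
have ab : b != a by apply: contraTneq ltba => ->; rewrite ltnn.
case: (eqVneq a j) ltba ab => [->|aj] ltba ab.
  rewrite (negbTE ab) !(mul0r, mulr0, subr0, mul1r).
  have -> : punctured col j i b = (b == i).
    rewrite /punctured; case: eqVneq => //= bi; apply/negP => /(col_blk plane)-/(_ lt) e.
    by rewrite e ltnn in ltba.
  case: eqVneq => [->|_]; last by rewrite !(mulr0, mul0r).
  by rewrite mul1r (sign_sq sgn) // eq_sym.
rewrite !(mul0r, sub0r); case: (eqVneq b j) => [e|]; last by rewrite !(mul0r, mulr0, oppr0).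
have -> : punctured col j i a = false; last by rewrite !(mul0r, mulr0, oppr0).
apply/negP => /(punctured_blk plane lt); rewrite -e leqNgt.
by rewrite ltba.
Qed.

Lemma dual_form_decomp q : dual_form q -> forall a b, q a b =
  \sum_(x : 'I_n * 'I_n | (blk x.2 < blk x.1)%N) q x.1 x.2 * retro_rel x.1 x.2 [:: a; b].
Proof.
move=> qd a b; apply/eqP; rewrite -subr_eq0; apply/eqP.
apply: (@dual_form_eq0 (fun a b => q a b - \sum_(x : 'I_n * 'I_n | (blk x.2 < blk x.1)%N)
   q x.1 x.2 * retro_rel x.1 x.2 [:: a; b])).
  apply: dual_form_sub => //; apply: dual_form_sum => x lt.
  by have /DP[] := retro_rel_dual lt.
move=> j i lt; rewrite (bigD1 (j, i)) //= retro_relE // !eqxx mulr1.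
rewrite big1 ?addr0 ?subrr // => -[x y] /andP[/= lt' ne]; rewrite retro_relE //.
case: eqVneq => [e|_]; last by rewrite mulr0.
case: eqVneq => [e'|_]; last by rewrite mulr0.
by rewrite e e' eqxx in ne.
Qed.

Lemma dual_pair (f : word n -> K) a b q : D q ->
  \sum_(x : 'I_n * 'I_n) q [:: x.1; x.2] * nf blk col s c f (a ++ [:: x.1; x.2] ++ b) = 0.
Proof.
case/DP => _ /dual_form_decomp qE; set E := nf _ _ _ _ _.
under eq_bigr => x _ do rewrite qE mulr_suml.
rewrite exchange_big big1 //= => y lt.
under eq_bigr => x _ do rewrite -mulrA.
rewrite -mulr_sumr.
under eq_bigr => x _ do rewrite -mulrA.
rewrite -mulr_sumr; apply/eqP; rewrite !mulf_eq0; apply/orP; right; apply/orP; right.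
apply/eqP; rewrite -[RHS](nf_rel plane sgn f a b lt) -/E.
under eq_bigr => x _ do rewrite mulr_suml.
rewrite exchange_big; apply: eq_bigr => h _ /=.
under eq_bigr => x _ do rewrite -mulrA.
rewrite -mulr_sumr; congr (_ * _).
rewrite -(sum_delta_fin (y.1, h) (fun x => E (a ++ [:: x.1; x.2] ++ b))).
rewrite -(sum_delta_fin (h, y.1) (fun x => E (a ++ [:: x.1; x.2] ++ b))).
rewrite mulr_sumr -sumrB; apply: eq_bigr => -[x1 x2] _ /=.
by rewrite !eqseq_cons !andbT !xpair_eqE mulrBl mulrA.
Qed.

Lemma retro_rel_lm j i : (blk i < blk j)%N ->
  retro_rel j i [:: j; i] = 1 /\ is_lm ord (retro_rel j i) [:: j; i].
Proof.
move=> lt; have e : retro_rel j i [:: j; i] = 1 by rewrite retro_relE // !eqxx.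
split=> //; split=> [|u]; first by rewrite e oner_neq0.
rewrite mulf_eq0 negb_or => /andP[_ hu] ne.
have [h Gh] : exists2 h, punctured col j i h & (u == [:: j; h]) || (u == [:: h; j]).
  apply/exists_inP; apply: contraNT hu; rewrite negb_exists => /forallP H.
  rewrite /line_rel big1 // => h Gh; have := H h; rewrite Gh /= negb_or.
  by case/andP=> /negbTE-> /negbTE->; rewrite mulr0 subrr mulr0.
case/orP: Gh ne => [/eqP-> | cc] ne.
  by case/orP=> /eqP e'; rewrite e' ?eqxx // in ne *; exact: word_lt_swap.
have [H1 H2] := word_lt_heavy lt (col_blk plane cc lt).
by case/orP=> /eqP->.
Qed.

Lemma dual_homog2 g : D g -> homog2 g.
Proof. by case/DP. Qed.

Lemma ideal_supp p : J p -> exists2 t, uniq t & forall w, p w != 0 -> w \in t.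
Proof.
move=> [m [x [a [b [g [Gg E]]]]]].
exists (undup [seq a y.1 ++ [:: y.2.1; y.2.2] ++ b y.1 | y : 'I_m * ('I_n * 'I_n)]).
  exact: undup_uniq.
move=> w; rewrite mem_undup E; apply: contraNT => nw.
rewrite big1 // => i _; rewrite shift_homog2; last exact: dual_homog2 (Gg i).
rewrite big1 ?mulr0 // => y _; case: eqVneq => [e|_]; last by rewrite mulr0.
by case/negP: nw; rewrite e; apply/codomP; exists (i, y).
Qed.

Lemma ideal_nf f p t : J p -> uniq t -> (forall w, p w != 0 -> w \in t) ->
  \sum_(w <- t) p w * nf blk col s c f w = 0.
Proof.
apply: ideal_pair; first exact: dual_homog2.
by move=> a b g; apply: dual_pair.
Qed.

(** Pair [p] with the functional reading the coefficient of [u] in normal forms. A sorted [u] would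
    contribute [p u], while the other words of [p] are smaller and their normal forms cannot involve
    [u]; yet the total is zero. *)
Lemma lm_descent p u : J p -> is_lm ord p u -> ~~ sorted_word blk u.
Proof.
move=> Jp [pu lm]; apply/negP => su; have [t ut pt] := ideal_supp Jp.
have := ideal_nf (fun w => (w == u)%:R) Jp ut pt.
rewrite (bigD1_seq u) ?pt //= (nf_sorted _ _ _ _ su) eqxx mulr1 big1 => [|w wu].
  by rewrite addr0 => e; rewrite e eqxx in pu.
have [->|pw] := eqVneq (p w) 0; first by rewrite mul0r.
rewrite (nf_low _ _ plane) ?mulr0 // => x lex; case: eqVneq lex => // -> leuw.
have := lm _ pw wu; case/orP: leuw => [/eqP e|uw wu']; first by rewrite e eqxx in wu.
by have := word_lt_trans uw wu'; rewrite word_lt_irr.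
Qed.

Lemma sorted_free q : (forall w, q w != 0 -> sorted_word blk w) -> J q ->
  forall w, q w = 0.
Proof.
move=> sq Jq u; have [//|qu] := eqVneq (q u) 0; have [t ut qt] := ideal_supp Jq.
rewrite -[RHS](ideal_nf (fun w => (w == u)%:R) Jq ut qt) -(sum_delta q ut (qt _ qu)).
apply: eq_big_seq => w _; have [->|qw] := eqVneq (q w) 0; first by rewrite mul0r mulr0.
by rewrite nf_sorted ?sq // mulrC.
Qed.

(** [Q] records the degree, so that one reduction serves both the standard basis and the graded
    dimensions. *)
Definition reducible (Q : word n -> Prop) (p : ncpoly K n) :=
  exists q, [/\ fsupp q, forall w, q w != 0 -> sorted_word blk w /\ Q w &
                J (fun w => p w - q w)].

Lemma reducible_mod Q p p' : J (fun w => p w - p' w) -> reducible Q p' -> reducible Q p.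
Proof.
move=> Jp [q [fq sq Jq]]; exists q; split=> //.
by apply: ideal_ext (ideal_lin 1 Jp Jq) => w; rewrite mul1r addrA subrK.
Qed.

Lemma reducible_weaken (Q Q' : word n -> Prop) p : (forall w, Q w -> Q' w) ->
  reducible Q p -> reducible Q' p.
Proof. by move=> QQ' [q [fq sq Jq]]; exists q; split=> // w /sq[? /QQ']. Qed.

Lemma reducible_sum Q (I : eqType) (t : seq I) (x : I -> K) (F : I -> ncpoly K n) :
  (forall i, i \in t -> x i != 0 -> reducible Q (F i)) ->
  reducible Q (fun w => \sum_(i <- t) x i * F i w).
Proof.
elim: t => [|i t IH] H.
  exists (fun=> 0); split=> [|w|]; [by exists [::] => w; rewrite eqxx|by rewrite eqxx|].
  by apply: ideal_ext (ideal0 _) => w; rewrite big_nil subr0.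
have [|q [[l fq] sq Jq]] := IH; first by move=> k kt; apply: H; rewrite inE kt orbT.
have [x0|xi] := eqVneq (x i) 0.
  exists q; split=> //; first by exists l.
  by apply: ideal_ext Jq => w; rewrite big_cons x0 mul0r add0r.
have [|q' [[l' fq'] sq' Jq']] := H i _ xi; first by rewrite inE eqxx.
have nz w : q w + x i * q' w != 0 -> q w != 0 \/ q' w != 0.
  by case: (eqVneq (q w) 0) => [->|]; [rewrite add0r mulf_eq0 negb_or => /andP[_]; right|left].
exists (fun w => q w + x i * q' w); split.
- by exists (l ++ l') => w /nz[/fq|/fq']; rewrite mem_cat => ->; rewrite ?orbT.
- by move=> w /nz[/sq|/sq'].
by apply: ideal_ext (ideal_lin (x i) Jq Jq') => w; rewrite big_cons; ring.
Qed.

Lemma reducible_mono w : reducible (fun u => size u = size w) (mono K w).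
Proof.
elim/(well_founded_ind (word_lt_wf blk)): w => w IH.
have [sw|/descentP[a [j [i [b [ew lt]]]]]] := boolP (sorted_word blk w).
  exists (mono K w); split=> [|u|]; rewrite /mono.
  - by exists [:: w] => u; rewrite inE; case: (u == w) => //=; rewrite eqxx.
  - by case: (eqVneq u w) => [->//|_]; rewrite eqxx.
  by apply: ideal_ext (ideal0 _) => u; rewrite subrr.
have hom : homog2 (retro_rel j i) by case/DP: (retro_rel_dual lt).
have [e1 [_ lm]] := retro_rel_lm lt.
pose t := [seq x <- enum {: 'I_n * 'I_n} | x != (j, i)].
apply: (@reducible_mod _ _ (fun u => \sum_(x <- t) - retro_rel j i [:: x.1; x.2]
   * mono K (a ++ [:: x.1; x.2] ++ b) u)).
  apply: ideal_ext (ideal_gen a b (retro_rel_dual lt)) => u.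
  rewrite shift_homog2 // (bigD1 (j, i)) //= e1 mul1r ew; congr (_ + _).
  rewrite -sumrN /t big_filter big_enum_cond /=.
  by apply: eq_bigr => x _; rewrite mulNr opprK.
apply: reducible_sum => -[x y]; rewrite mem_filter => /andP[/= ne _]; rewrite oppr_eq0 => nz.
have -> : size w = size (a ++ [:: x; y] ++ b) by rewrite ew !size_cat.
apply: IH; rewrite ew; have [_ _ _ _ mon] := word_lt_order blk; apply: mon.
by apply: lm => //; apply: contraNneq ne => -[-> ->].
Qed.

Lemma reducible_fsupp (Q : word n -> Prop) p : fsupp p ->
  (forall w u, p w != 0 -> size u = size w -> Q u) -> reducible Q p.
Proof.
case=> t pt pQ; apply: (@reducible_mod _ _ (fun u => \sum_(w <- undup t) p w * mono K w u)).
  apply: ideal_ext (ideal0 _) => u; have [ut|ut] := boolP (u \in t).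
    rewrite -[X in X - _](sum_delta p (undup_uniq t) (_ : u \in undup t)) ?mem_undup //.
    rewrite -sumrB big1 // => w _; by rewrite /mono [w == u]eq_sym mulrC subrr.
  have -> : p u = 0 by apply/eqP; apply: contraNT ut => /pt.
  rewrite big1_seq ?subrr // => w /=; rewrite mem_undup => wt.
  by rewrite /mono; case: eqVneq => [e|_]; [rewrite e wt in ut | rewrite mulr0].
apply: reducible_sum => w _ pw; apply: reducible_weaken (reducible_mono w) => u.
exact: pQ.
Qed.

(** Every leading word of [J] has a descent, so any part of [J] whose leading words include all the
    [y_j y_i] qualifies; both families of relations pass this test. *)
Lemma groebner_of (G : ncpoly K n -> Prop) : (forall g, G g -> J g) ->
  (forall j i, (blk i < blk j)%N -> exists2 g, G g & is_lm ord g [:: j; i]) ->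
  groebner ord G J.
Proof.
move=> GJ Glm; split=> // p u Jp lmu.
have [a [j [i [b [eu lt]]]]] := descentP (lm_descent Jp lmu).
have [g Gg lmg] := Glm j i lt; exists g, [:: j; i]; split=> //.
by apply/infixP; exists a, b.
Qed.

Lemma dual_ideal g : D g -> J g.
Proof.
move=> Dg; apply: ideal_ext (ideal_gen [::] [::] Dg) => w.
by have := shift_cat [::] g [::] w; rewrite /= cats0.
Qed.

Lemma is_lm_ext (p q : ncpoly K n) w : p =1 q -> is_lm ord p w -> is_lm ord q w.
Proof. by move=> e [pw lm]; split=> [|u]; rewrite -e //; apply: lm. Qed.

Lemma lm_uniq (p : ncpoly K n) u w : is_lm ord p u -> is_lm ord p w -> u = w.
Proof.
move=> [pu lu] [pw lw]; apply/eqP; case: (eqVneq u w) => // ne.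
have uw := lw _ pu ne; rewrite eq_sym in ne; have wu := lu _ pw ne.
by have := word_lt_trans uw wu; rewrite word_lt_irr.
Qed.

(** By [retro_relE] the leading word is the only retrograde word in its relation, so no other
    leading word divides one of its terms. *)
Lemma reduced_retro (G : ncpoly K n -> Prop) (rho : 'I_n -> 'I_n -> ncpoly K n) :
  (forall j i, (blk i < blk j)%N -> rho j i =1 retro_rel j i) ->
  (forall g, G g <-> exists j i, (blk i < blk j)%N /\ forall w, g w = rho j i w) ->
  reduced_groebner ord G J.
Proof.
move=> rE GP.
have GE g : G g -> exists j i, (blk i < blk j)%N /\ g =1 retro_rel j i.
  by move=> /GP[j [i [lt e]]]; exists j, i; split=> // w; rewrite e rE.
split.
- apply: groebner_of => [g /GE[j [i [lt e]]]|j i lt].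
    by apply: (@ideal_ext _ _ _ (retro_rel j i)) => [w|];
      [rewrite e | exact/dual_ideal/retro_rel_dual].
  exists (retro_rel j i); last by case: (retro_rel_lm lt).
  by apply/GP; exists j, i; split=> // w; rewrite rE.
- move=> g /GE[j [i [lt e]]]; have [e1 lm] := retro_rel_lm lt.
  by exists [:: j; i]; rewrite e; split=> //; apply: is_lm_ext lm => w; rewrite e.
move=> g g' /GE[j [i [lt e]]] /GE[j' [i' [lt' e']]] [w0 ne] u w gu lmw.
have [e1 lm'] := retro_rel_lm lt'.
have -> : w = [:: j'; i'].
  by apply: lm_uniq lm'; apply: is_lm_ext lmw => x; rewrite e'.
apply/negP => /infixP[a [b eu]].
have hom : homog2 (retro_rel j i) by case/DP: (retro_rel_dual lt).
rewrite e in gu; have := hom _ gu; rewrite eu !size_cat /= => sz.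
have ea : a = [::] by case: (a) sz => //= ? ?; lia.
have eb : b = [::] by case: (b) sz => //= ? ?; lia.
rewrite eu ea eb /= retro_relE // in gu.
case: (eqVneq j' j) gu => [ej|_] /=; last by rewrite eqxx.
case: (eqVneq i' i) => [ei|_] /=; last by rewrite eqxx.
by move=> _; case/eqP: ne; rewrite e e' ej ei.
Qed.

Lemma standardP w : standard ord J w <-> sorted_word blk w.
Proof.
split=> [st|sw [p [u [Jp lmu iu]]]].
  apply: contraT => /descentP[a [j [i [b [ew lt]]]]]; case: st.
  exists (retro_rel j i), [:: j; i]; split; first exact/dual_ideal/retro_rel_dual.
    by case: (retro_rel_lm lt).
  by apply/infixP; exists a, b.
by have := lm_descent Jp lmu; rewrite (sorted_word_infix iu sw).
Qed.

Lemma initial_idealP p : initial_ideal ord J p <->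
  ideal (fun m => exists j i, retrograde blk j i /\ forall u, m u = mono K [:: j; i] u) p.
Proof.
split; apply: ideal_trans => g a b.
  move=> [q [w [Jq lmw e]]]; have [a' [j [i [b' [ew lt]]]]] := descentP (lm_descent Jq lmw).
  apply: (@ideal_ext _ _ _ (shift (a ++ a') (mono K [:: j; i]) (b' ++ b))) => [u|].
    rewrite shift_mono (_ : shift a g b u = shift a (mono K w) b u); last first.
      by rewrite /shift; case: ifP => // _; rewrite e.
    by rewrite shift_mono ew -!catA.
  by apply: ideal_gen; exists j, i.
move=> [j [i [lt e]]]; apply: ideal_gen; exists (retro_rel j i), [:: j; i]; split=> //.
  exact/dual_ideal/retro_rel_dual.
by case: (retro_rel_lm lt).
Qed.

Lemma basis_standard : basis_mod J (standard ord J).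
Proof.
split=> [p fp|q _ sq Jq].
  have [q [fq sq Jq]] := @reducible_fsupp (fun=> True) p fp (fun _ _ _ _ => I).
  by exists q; split=> // w /sq[sw _]; apply/standardP.
by apply: sorted_free => // w /sq/standardP.
Qed.

Lemma graded_dim_sorted d (W : seq (word n)) : uniq W ->
  (forall w, (w \in W) = (size w == d) && sorted_word blk w) ->
  graded_dim J d (size W).
Proof.
move=> uW memW; exists (fun i => mono K (nth [::] W i)); split.
- move=> i; exists [:: nth [::] W i] => w; rewrite /mono inE.
  by case: (eqVneq w (nth [::] W i)) => //= _; rewrite eqxx.
- move=> i w; rewrite /mono; case: (eqVneq w (nth [::] W i)) => [->|]; last by rewrite eqxx.
  by have := mem_nth [::] (ltn_ord i); rewrite memW => /andP[/eqP].
- move=> x Jx i; pose q w := \sum_i0 x i0 * mono K (nth [::] W i0) w.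
  have q0 : q (nth [::] W i) = 0.
    apply: sorted_free Jx _ => w; apply: contraNT => sw.
    rewrite /q big1 // => k _; rewrite /mono; case: eqVneq => [e|_]; last by rewrite mulr0.
    by have := mem_nth [::] (ltn_ord k); rewrite memW -e (negbTE sw) andbF.
  move: q0; rewrite /q (bigD1 i) //= /mono eqxx mulr1 big1 ?addr0 // => k ki.
  rewrite nth_uniq //; move: ki; rewrite -(inj_eq val_inj) eq_sym => /negbTE->.
  by rewrite mulr0.
move=> p fp sp; have [|q [fq sq Jq]] := @reducible_fsupp (fun u => size u = d) p fp.
  by move=> w u /sp <-.
exists (fun i => q (nth [::] W i)); apply: ideal_ext Jq => w; congr (_ - _).
rewrite -(big_mkord xpredT (fun i => q (nth [::] W i) * mono K (nth [::] W i) w)).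
rewrite -(big_nth [::] xpredT (fun v => q v * mono K v w)).
have [ww|nw] := boolP (w \in W).
  rewrite -{1}(sum_delta q uW ww); apply: eq_bigr => v _.
  by rewrite /mono eq_sym mulrC.
have [->|/sq[sw dw]] := eqVneq (q w) 0; last by rewrite memW dw eqxx sw in nw.
rewrite big1_seq // => v /= vW; rewrite /mono; case: eqVneq => [e|_]; last by rewrite mulr0.
by rewrite e vW in nw.
Qed.
End Quadratic.

(** * The Hilbert series *)

Section Counting.
Variables (n r : nat) (blk : 'I_n -> 'I_r).

Fixpoint normal_words d m : seq (word n) :=
  if d is d'.+1 then
    [seq rcons w j | j <- [seq j <- enum 'I_n | (blk j < m)%N], w <- normal_words d' (blk j).+1]
  else [:: [::]].

Lemma sorted_word_rcons w j : sorted_word blk (rcons w j) =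
  sorted_word blk w && all (fun i => blk i <= blk j)%N w.
Proof.
rewrite /sorted_word map_rcons !(sorted_pairwise leq_trans) pairwise_rcons andbC.
by rewrite all_map.
Qed.

Lemma mem_normal_words d m w : (w \in normal_words d m) =
  [&& size w == d, sorted_word blk w & all (fun i => blk i < m)%N w].
Proof.
elim: d m w => [|d IH] m w /=; first by rewrite inE; case: w.
apply/allpairsPdep/idP => [[j [v [+ + ->]]] | ].
  rewrite mem_filter IH => /andP[lt _] /and3P[/eqP sv sw al].
  rewrite size_rcons sv eqxx sorted_word_rcons sw all_rcons lt /=; apply/andP; split=> //.
  by apply/allP => i /(allP al) /= le; apply: leq_trans lt.
case/lastP: w => [|v j]; first by rewrite eq_sym.
rewrite size_rcons eqSS sorted_word_rcons all_rcons => /and4P[sv /andP[sw al] lt _].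
by exists j, v; rewrite mem_filter lt mem_enum IH sv sw.
Qed.

Lemma uniq_normal_words d m : uniq (normal_words d m).
Proof.
elim: d m => [|d IH] m //=; apply: allpairs_uniq_dep.
- by rewrite filter_uniq // enum_uniq.
- by move=> j _; apply: IH.
by move=> [j v] [j' v'] _ _ /= /rcons_inj[-> ->].
Qed.

Definition letters m := #|[set i | blk i == m :> nat]|.

(** Words are split by whether their last letter is in block [m]; such a letter may follow any
    admissible word. On generating series this is division by [1 - e t] with [e] the size of block
    [m]. *)
Lemma size_normal_wordsS d m : size (normal_words d.+1 m.+1) =
  (size (normal_words d.+1 m) + letters m * size (normal_words d m.+1))%N.
Proof.
rewrite /= !size_allpairs_dep !sumnE !big_map !big_filter !big_enum_cond /=.
rewrite (bigID (fun j => blk j < m)%N) /=; congr (_ + _)%N.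
  by apply: eq_bigl => j; rewrite andb_idl // => /ltnW.
rewrite /letters cardE -sum1_size big_distrl /= big_enum_cond /=.
apply: eq_big => j; first by rewrite ltnS -leqNgt -eqn_leq inE andbT.
by rewrite ltnS -leqNgt -eqn_leq mul1n => /eqP->.
Qed.

Lemma normal_words_series d m :
  let P : {poly int} := \prod_(0 <= p < m) (1 - (letters p)%:R *: 'X) in
  \sum_(k < d.+1) (size (normal_words (d - k) m))%:R * P`_k = (d == 0%N)%:R.
Proof.
elim: m d => [|m IH] d P.
  rewrite /P big_geq // big_ord_recl /= coef1 eqxx mulr1 subn0 big1 => [|k _].
    rewrite addr0; case: d => //= d.
    by rewrite size_allpairs_dep sumnE big_map big_filter big_pred0.
  by rewrite coef1 mulr0.
move: (IH d); rewrite /= /P big_nat_recr //=; set Q := \prod_(_ <= _ < _) _ => <-.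
set e := (letters m)%:R : int.
have E k : (Q * (1 - e *: 'X))`_k = Q`_k - (if k is k'.+1 then e * Q`_k' else 0).
  rewrite mulrBr mulr1 coefB -scalerAr coefZ coefMX; case: k => //=.
  by rewrite mulr0.
under eq_bigr => k _ do rewrite E mulrBr.
rewrite sumrB [X in _ - X]big_ord_recl mulr0 add0r /=.
(* The terms at [k = d] count only the empty word and agree; for [k < d] the length [d - k] is
   positive and the recurrence applies. *)
rewrite big_ord_recr [RHS]big_ord_recr /= subnn addrAC; congr (_ + _).
rewrite -sumrB; apply: eq_bigr => k _; rewrite /bump /= add1n.
have -> : (d - k = (d - k.+1).+1)%N by have := ltn_ord k; lia.
rewrite size_normal_wordsS natrD natrM; ring.
Qed.
End Counting.

Section Conclusions.
Variables (K : fieldType) (n r : nat) (blk : 'I_n -> 'I_r).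
Variables (col : 'I_n -> 'I_n -> 'I_n -> bool) (s : K) (c : 'I_n -> 'I_n -> K).
Hypothesis plane : plane_axioms blk col.
Hypothesis sgn : sign_axioms col s c.
Variable D : ncpoly K n -> Prop.
Hypothesis DP : forall q, D q <-> homog2 q /\ dual_form col s c (fun a b => q [:: a; b]).

Lemma quadratic_conclusions : common_conclusions blk (word_lt blk) (ideal D).
Proof.
split.
- by move=> p; apply: (initial_idealP plane sgn DP).
- by move=> w; apply: (standardP plane sgn DP).
- exact: (basis_standard plane sgn DP).
exists (fun d => size (normal_words blk d r)); split=> [d|P d].
  apply: (graded_dim_sorted plane sgn DP); first exact: uniq_normal_words.
  move=> w; rewrite mem_normal_words; congr (_ && _).
  by rewrite [X in _ && X](_ : _ = true) ?andbT //; apply/allP.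
rewrite -(normal_words_series blk d r); apply: eq_bigr => k _; congr (_ * nth _ _ _).
by rewrite /P big_mkord.
Qed.
End Conclusions.

(** * Matroids from circuits *)

Section Independence.
Local Open Scope nat_scope.
Variables (n : nat) (C : {set {set 'I_n}}).
Hypothesis ax : circuit_axioms C.

Lemma circuit_elim C1 C2 e : C1 \in C -> C2 \in C -> C1 != C2 -> e \in C1 -> e \in C2 ->
  exists2 C3, C3 \in C & C3 \subset (C1 :|: C2) :\ e.
Proof. by case: ax => _ _ H h1 h2 ne e1 e2; apply: H => //; rewrite inE e1. Qed.

Lemma circuit_incomparable C1 C2 : C1 \in C -> C2 \in C -> C1 \subset C2 -> C1 = C2.
Proof. by case: ax => _ H _; apply: H. Qed.

Lemma indepPn (I : {set 'I_n}) : reflect (exists2 X, X \in C & X \subset I) (~~ indep C I).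
Proof.
rewrite /indep negb_forall; apply: (iffP existsP) => [[X]|[X XC XI]].
  by rewrite negb_imply negbK => /andP[]; exists X.
by exists X; rewrite XC XI.
Qed.

Lemma indepP (I : {set 'I_n}) : reflect (forall X, X \in C -> ~~ (X \subset I)) (indep C I).
Proof. by apply: (iffP forallP) => H X; [apply/implyP/H | apply/implyP/H]. Qed.

Lemma indep_sub (I I' : {set 'I_n}) : I' \subset I -> indep C I -> indep C I'.
Proof.
move=> sub /indepP H; apply/indepP => X XC; apply: contra (H _ XC) => XI.
exact: subset_trans XI sub.
Qed.

(** [I2] is moved towards [I1] by exchanging some [f] for an [e] of [I1]. If no exchange stays
    independent, each [f] gives a circuit through [e] avoiding [f]; two different ones exist, and
    eliminating [e] leaves a circuit inside the independent set [I3]. *)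
Lemma indep_augment (I1 I2 : {set 'I_n}) : indep C I1 -> indep C I2 -> (#|I1| < #|I2|)%N ->
  exists2 e, e \in I2 :\: I1 & indep C (e |: I1).
Proof.
move=> i1 i2 lt12.
suff H m (I3 : {set 'I_n}) : (#|I1 :\: I3| <= m)%N -> indep C I3 -> (#|I1| < #|I3|)%N ->
    I3 \subset I1 :|: I2 -> exists2 e, e \in I2 :\: I1 & indep C (e |: I1).
  by apply: (H #|I1 :\: I2| I2) => //; apply: subsetUr.
have base (I3' : {set 'I_n}) : I1 \subset I3' -> indep C I3' -> (#|I1| < #|I3'|)%N ->
    I3' \subset I1 :|: I2 -> exists2 e, e \in I2 :\: I1 & indep C (e |: I1).
  move=> s13 i3 lt13 sub3; have [x x31] : exists x, x \in I3' :\: I1.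
    by apply/set0Pn; rewrite setD_eq0; apply: contraL lt13 => /subset_leq_card; rewrite leqNgt.
  have /setDP[x3 x1] := x31; exists x.
    by rewrite inE x1; have := subsetP sub3 _ x3; rewrite inE (negbTE x1).
  by apply: indep_sub i3; rewrite subUset s13 sub1set x3.
elim: m I3 => [|m IH] I3 le i3 lt13 sub3.
  by apply: (base I3) => //; rewrite -setD_eq0 -cards_eq0 -leqn0.
have [s13|ns] := boolP (I1 \subset I3); first exact: (base I3).
have [e e13] : exists e, e \in I1 :\: I3 by apply/set0Pn; rewrite setD_eq0.
have /setDP[e1 e3] := e13.
pose T f := e |: (I3 :\ f).
have [/exists_inP[f f31 iT] | ] := boolP [exists f in I3 :\: I1, indep C (T f)].
  have /setDP[f3 f1] := f31.
  apply: (IH (T f)) => //.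
  - rewrite -ltnS; apply: leq_trans le; apply/proper_card/properP; split.
      apply/subsetP => x; rewrite !inE !negb_or negb_and negbK.
      case/andP=> /andP[xe /orP[/eqP->|->]] //; by rewrite (negbTE f1).
    by exists e => //; rewrite !inE eqxx.
  - by rewrite /T cardsU1 !inE (negbTE e3) andbF /= add1n (cardsD1 f I3) f3 add1n in lt13 *.
  apply/subsetP => x; rewrite !inE => /orP[/eqP->|/andP[_ /(subsetP sub3)]]; first by rewrite e1.
  by rewrite inE.
rewrite negb_exists_in => /forall_inP dep.
have circ f : f \in I3 :\: I1 -> exists X, [/\ X \in C, X \subset e |: I3, e \in X & f \notin X].
  move=> f31; have /indepPn[X XC XT] := dep f f31; have /setDP[f3 f1] := f31.
  exists X; split=> //.
  - by apply: subset_trans XT _; rewrite setUS // subD1set.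
  - apply: contraT => eX; case/negP: (indepP _ i3 X XC).
    apply/subsetP => x xX; have := subsetP XT x xX; rewrite !inE.
    by case/orP=> [/eqP ex|/andP[]//]; rewrite -ex xX in eX.
  apply: contraL f1 => fX; have := subsetP XT f fX; rewrite !inE eqxx orbF => /eqP->.
  by rewrite e1.
have [g g31] : exists g, g \in I3 :\: I1.
  by apply/set0Pn; rewrite setD_eq0; apply: contraL lt13 => /subset_leq_card; rewrite leqNgt.
have [X [XC Xs eX gX]] := circ g g31.
have [h h31 hX] : exists2 h, h \in I3 :\: I1 & h \in X.
  apply/exists_inP; apply: contraT; rewrite negb_exists_in => /forall_inP H.
  case/negP: (indepP _ i1 X XC); apply/subsetP => x xX.
  have := subsetP Xs x xX; rewrite !inE => /orP[/eqP->//|x3].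
  by apply: contraT => x1; have := H x; rewrite !inE x1 x3 xX => /(_ isT).
have [Y [YC Ys eY hY]] := circ h h31.
have XY : X != Y by apply: contraTneq hX => ->.
have [Z ZC Zs] := circuit_elim XC YC XY eX eY.
case/negP: (indepP _ i3 Z ZC); apply: subset_trans Zs _; apply/subsetP => x.
by rewrite !inE => /andP[xe /orP[/(subsetP Xs)|/(subsetP Ys)]]; rewrite !inE (negbTE xe).
Qed.

Lemma indep_extend (A I : {set 'I_n}) : indep C A -> indep C I -> (#|A| <= #|I|)%N ->
  exists J, [/\ indep C J, A \subset J, J \subset A :|: I & #|J| = #|I|].
Proof.
move=> iA iI; move: {2}(#|I| - #|A|)%N (erefl (#|I| - #|A|)%N) => m.
elim: m A iA => [|m IH] A iA e le.
  by exists A; split=> //; [exact: subsetUl | lia].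
have [|x /setDP[xI xA] ix] := indep_augment iA iI; first lia.
have cx : #|x |: A| = #|A|.+1 by rewrite cardsU1 xA.
have [||J [iJ sJ JJ cJ]] := IH _ ix; [lia | lia |].
exists J; split=> //; first exact: subset_trans (subsetUr _ _) sJ.
by apply: subset_trans JJ _; rewrite -setUA subUset sub1set inE xI orbT /=.
Qed.

Lemma indep0 : indep C set0.
Proof.
apply/indepP => X XC; apply/negP; rewrite subset0 => /eqP e.
by case: ax => n0 _ _; rewrite -e XC in n0.
Qed.

Lemma mrank_attained (X : {set 'I_n}) : exists2 I : {set 'I_n},
  indep C I && (I \subset X) & #|I| = mrank C X.
Proof.
have [|I iI e] := @eq_bigmax_cond _ [pred I : {set 'I_n} | indep C I && (I \subset X)]
  (fun I : {set 'I_n} => #|I|).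
  by apply/card_gt0P; exists set0; rewrite inE indep0 sub0set.
by exists I.
Qed.

Lemma leq_mrank (X I : {set 'I_n}) : indep C I -> I \subset X -> (#|I| <= mrank C X)%N.
Proof. by move=> iI IX; apply: leq_bigmax_cond; rewrite iI. Qed.

Lemma flatP (F : {set 'I_n}) :
  reflect (forall X x, X \in C -> x \in X -> X :\ x \subset F -> x \in F) (flat C F).
Proof.
apply: (iffP forallP) => [H X x XC xX sF | H X].
  apply: contraT => xF; have /implyP/(_ XC)/implyP := H X.
  suff -> : X :&: F = X :\ x.
    by rewrite (cardsD1 x X) xX add1n subn1 eqxx => /(_ isT)/subsetP/(_ x xX); rewrite (negbTE xF).
  apply/eqP; rewrite eqEsubset subsetI subD1set sF !andbT.
  by apply/subsetP => y; rewrite !inE => /andP[-> yF]; rewrite andbT; apply: contraNneq xF => <-.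
apply/implyP => XC; apply/implyP => /eqP e; apply/subsetP => x xX; apply: contraT => xF.
case/negP: (xF); apply: (H X) => //.
have sub : X :&: F \subset X :\ x.
  by apply/subsetP => y; rewrite !inE => /andP[-> yF]; rewrite andbT; apply: contraNneq xF => <-.
have : X :&: F == X :\ x by rewrite eqEcard sub e (cardsD1 x X) xX; lia.
by move/eqP=> <-; apply: subsetIr.
Qed.

(** By augmentation no independent subset of this set exceeds [I]. If a circuit [X] left it at the
    single point [x], extending [X :\ x] by elements of [x |: I] would either contain [X] or be too
    large a subset. *)
Lemma span_flat (I : {set 'I_n}) : indep C I ->
  flat C [set e | (e \in I) || ~~ indep C (e |: I)].
Proof.
move=> iI; set F := [set e | _].
have max (A : {set 'I_n}) : indep C A -> A \subset F -> (#|A| <= #|I|)%N.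
  move=> iA AF; rewrite leqNgt; apply/negP => /(indep_augment iI iA)[x /setDP[xA xI] ix].
  by have := subsetP AF x xA; rewrite inE (negbTE xI) ix.
apply/flatP => X x XC xX XF; apply: contraT => xF.
have [xI ix] : x \notin I /\ indep C (x |: I).
  by move: xF; rewrite inE negb_or negbK => /andP[].
have iX : indep C (X :\ x).
  apply/indepP => Y YC; apply/negP => YX.
  have := circuit_incomparable YC XC (subset_trans YX (subD1set _ _)) => e.
  by have := subsetP YX x; rewrite e xX !inE eqxx => /(_ isT).
have cx : #|x |: I| = #|I|.+1 by rewrite cardsU1 xI.
have le : (#|X :\ x| <= #|x |: I|)%N by rewrite cx ltnW // ltnS; apply: max.
have [J [iJ sJ JJ cJ]] := indep_extend iX ix le.
have [xJ|xJ] := boolP (x \in J).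
  case/negP: (indepP _ iJ X XC); apply/subsetP => y yX.
  have [->//|yx] := eqVneq y x; by apply: (subsetP sJ); rewrite !inE yx.
have : (#|J| <= #|I|)%N; last by rewrite cJ cx ltnn.
apply: max => //; apply/subsetP => y yJ; have := subsetP JJ y yJ; rewrite in_setU.
case/orP=> [/(subsetP XF)//|]; rewrite in_setU1 => /orP[/eqP e|yI].
  by rewrite -e yJ in xJ.
by rewrite inE yI.
Qed.
End Independence.

(** * Lines of a simple matroid *)

Section SimpleMatroid.
Local Open Scope nat_scope.
Variables (n : nat) (C : {set {set 'I_n}}).
Hypotheses (ax : circuit_axioms C) (simple : simple_matroid C).

Definition collinear (a b c : 'I_n) : bool := [set a; b; c] \in C.
Notation col := collinear.

Lemma collinear_rot a b c : col a b c = col b c a.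
Proof. by rewrite /collinear -setUA setUC. Qed.

Lemma collinear_swap a b c : col a b c = col b a c.
Proof. by rewrite /collinear (setUC [set a]). Qed.

Lemma collinear_irr a b : col a a b = false.
Proof. by apply/negP => /simple; rewrite setUid cards2; case: (_ != _). Qed.

Lemma cards3 (a b c : 'I_n) : (#|[set a; b; c]| <= 3)%N.
Proof. by rewrite (leq_trans (leq_card_setU _ _)) // cards2 cards1; case: (_ != _). Qed.

Lemma small_circuit (X : {set 'I_n}) a b c : X \in C -> X \subset [set a; b; c] -> col a b c.
Proof.
move=> XC sub; have : X == [set a; b; c].
  by rewrite eqEcard sub (leq_trans (cards3 _ _ _)) // simple.
by move=> /eqP e; rewrite /collinear -e.
Qed.

Lemma small_circuit2 (X : {set 'I_n}) a b : X \in C -> ~~ (X \subset [set a; b]).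
Proof.
move=> XC; apply/negP => /subset_leq_card; rewrite leqNgt.
by rewrite (leq_ltn_trans _ (simple XC)) // cards2; case: (_ != _).
Qed.

Lemma collinear_trans a b c d : col a b c -> col a b d -> c != d -> col a c d.
Proof.
move=> cc cd ne; have [X XC sX] : exists2 X, X \in C &
    X \subset ([set a; b; c] :|: [set a; b; d]) :\ b.
  apply: circuit_elim => //; rewrite ?inE ?eqxx ?orbT //.
  apply: contraNneq ne => e; have /setP/(_ c) := e; rewrite !inE eqxx orbT => /esym.
  case/orP=> [/orP[]|//] /eqP ec.
    by move: cc; rewrite ec collinear_rot collinear_rot collinear_irr.
  by move: cc; rewrite ec collinear_rot collinear_irr.
apply: (small_circuit XC); apply/subsetP => x /(subsetP sX); rewrite !inE.
by case: (x == b); rewrite ?orbF ?orbT //=; case: (x == a); case: (x == c).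
Qed.

Definition mem_line (i j k : 'I_n) : bool := [|| k == i, k == j | col i j k].

Lemma mem_lineC i j k : mem_line i j k = mem_line j i k.
Proof. by rewrite /mem_line collinear_swap orbCA. Qed.

Lemma mem_line_step i j p x : mem_line i j p -> p != i -> mem_line i j x -> mem_line i p x.
Proof.
rewrite /mem_line => + pi; rewrite (negbTE pi) /=; case/orP=> [/eqP->//|cp].
have [//|xi] := eqVneq x i; have [//|xp] := eqVneq x p => /=.
case/orP=> [/eqP->|cx]; first by rewrite collinear_swap collinear_rot.
by rewrite (collinear_trans cp cx) // eq_sym.
Qed.

Lemma mem_line_sub i j p q x : mem_line i j p -> mem_line i j q -> p != q ->
  mem_line i j x -> mem_line p q x.
Proof.
move=> lp lq pq lx; have [qi|qi] := eqVneq q i.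
  by rewrite mem_lineC qi; apply: (mem_line_step lp) lx; rewrite -qi.
have lp' := mem_line_step lq qi lp; have lx' := mem_line_step lq qi lx.
rewrite mem_lineC in lp'; rewrite mem_lineC in lx'.
by rewrite mem_lineC; apply: mem_line_step lp' pq lx'.
Qed.

Lemma mem_line_col i j p q x : mem_line i j p -> mem_line i j q -> mem_line i j x ->
  p != q -> x != p -> x != q -> col p q x.
Proof.
move=> lp lq lx pq xp xq; have := mem_line_sub lp lq pq lx.
by rewrite /mem_line (negbTE xp) (negbTE xq).
Qed.

Lemma mem_line_sub' i j p q x : i != j -> mem_line i j p -> mem_line i j q -> p != q ->
  mem_line p q x -> mem_line i j x.
Proof.
move=> ij lp lq pq; apply: mem_line_sub => //.
  by apply: (mem_line_sub lp lq pq); rewrite /mem_line eqxx.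
by apply: (mem_line_sub lp lq pq); rewrite /mem_line eqxx orbT.
Qed.

Lemma flat_col (F : {set 'I_n}) a b c : flat C F -> col a b c -> a \in F -> b \in F -> c \in F.
Proof.
move=> /flatP H cc aF bF; apply: (H [set a; b; c]) => //; first by rewrite !inE eqxx orbT.
by apply/subsetP => x; rewrite !inE => /andP[/negbTE->]; rewrite orbF => /orP[]/eqP->.
Qed.

Lemma subset_pick3 (X : {set 'I_n}) x p q : p \in X :\ x -> q \in X :\ x -> p != q ->
  (3 < #|X|)%N -> x \in X -> exists y, [/\ y \in X :\ x, y != p & y != q].
Proof.
move=> pX qX pq card xX; have [y] : exists y, y \in (X :\ x) :\ p :\ q.
  apply/set0Pn; rewrite -cards_eq0 -lt0n.
  have qp : q \in X :\ x :\ p by rewrite in_setD1 eq_sym pq.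
  have e1 := cardsD1 x X; have e2 := cardsD1 p (X :\ x).
  have e3 := cardsD1 q (X :\ x :\ p); rewrite xX in e1; rewrite pX in e2; rewrite qp in e3.
  lia.
by rewrite in_setD1 => /andP[yq]; rewrite in_setD1 => /andP[yp yX]; exists y.
Qed.

(** A circuit with more than three elements, all but one on the line, would properly contain a
    collinear triple; so only three-element circuits matter. *)
Lemma line_flat i j : i != j -> flat C [set k | mem_line i j k].
Proof.
move=> ij; apply/flatP => X x XC xX sub.
have [p [q [pX qX pq]]] : exists p q, [/\ p \in X :\ x, q \in X :\ x & p != q].
  have /card_gt1P[p [q [pX qX pq]]] : (1 < #|X :\ x|)%N.
    by have := simple XC; rewrite (cardsD1 x) xX.
  by exists p, q.
have lp := subsetP sub p pX; have lq := subsetP sub q qX; rewrite !inE in lp lq.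
have [e|gt] := leqP #|X| 3.
  have eX : [set p; q] = X :\ x.
    apply/eqP; rewrite eqEcard subUset !sub1set pX qX cards2 pq /=.
    by move: e; rewrite (cardsD1 x X) xX add1n ltnS.
  have cc : col p q x by rewrite /collinear setUC eX setD1K.
  rewrite inE; by apply: (mem_line_sub' ij lp lq pq); rewrite /mem_line cc !orbT.
have [y [yX yp yq]] := subset_pick3 pX qX pq gt xX.
have ly := subsetP sub y yX; rewrite inE in ly.
have cc : col p q y by apply: mem_line_col lp lq ly pq yp yq.
have e : [set p; q; y] = X.
  apply: (circuit_incomparable ax) => //.
  by move: pX qX yX; rewrite !subUset !sub1set !inE => /andP[_ ->] /andP[_ ->] /andP[_ ->].
by move: gt; rewrite -e ltnNge cards3.
Qed.

Lemma line_closure i j : i != j -> mjoin C [set i] [set j] = [set k | mem_line i j k].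
Proof.
move=> ij; apply/eqP; rewrite eqEsubset; apply/andP; split.
  apply: (bigcap_inf [set k | mem_line i j k]); rewrite line_flat //=.
  by apply/subsetP => k; rewrite !inE /mem_line => /orP[]->; rewrite ?orbT.
apply/bigcapsP => F /andP[fF]; rewrite subUset !sub1set => /andP[iF jF].
apply/subsetP => k; rewrite !inE => /or3P[/eqP->//|/eqP->//|cc].
exact: flat_col fF cc iF jF.
Qed.

Lemma indep_pair i j : indep C [set i; j].
Proof. by apply/indepP => X /small_circuit2. Qed.

Lemma rank2_line i j : i != j -> rank2flat C [set k | mem_line i j k].
Proof.
move=> ij; split; first exact: line_flat.
apply/eqP; rewrite eqn_leq; apply/andP; split.
  have [I /andP[iI sI] <-] := mrank_attained ax [set k | mem_line i j k].
  rewrite leqNgt; apply/negP => gt.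
  have [x xI] : exists x, x \in I by apply/card_gt0P; lia.
  have /card_gt1P[p [q [pI qI pq]]] : (1 < #|I :\ x|)%N.
    by have := cardsD1 x I; rewrite xI; lia.
  move: pI qI; rewrite !inE => /andP[px pI] /andP[qx qI].
  have lx := subsetP sI x xI; have lp := subsetP sI p pI; have lq := subsetP sI q qI.
  rewrite !inE in lx lp lq.
  have cc : col p q x by apply: mem_line_col lp lq lx pq _ _; rewrite eq_sym.
  by case/negP: (indepP _ _ iI _ cc); rewrite !subUset !sub1set pI qI xI.
have := leq_mrank (indep_pair i j) (X := [set k | mem_line i j k]).
by rewrite cards2 ij; apply; rewrite subUset !sub1set !inE /mem_line !eqxx orbT.
Qed.

Lemma rank2_eq_line F i j : rank2flat C F -> i \in F -> j \in F -> i != j ->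
  F = [set k | mem_line i j k].
Proof.
move=> [fF rF] iF jF ij; apply/eqP; rewrite eqEsubset; apply/andP; split; last first.
  apply/subsetP => k; rewrite !inE => /or3P[/eqP->//|/eqP->//|cc].
  exact: flat_col fF cc iF jF.
apply/subsetP => k kF; rewrite inE; apply: contraT => nk.
move: (nk); rewrite !negb_or => /and3P[ki kj nc].
have : indep C [set i; j; k].
  apply/indepP => X XC; apply/negP => /(small_circuit XC); exact/negP.
move/leq_mrank => /(_ F); rewrite rF !subUset !sub1set iF jF kF => /(_ isT).
by rewrite setUC cardsU1 !inE negb_or ki kj cards2 ij.
Qed.

(** A largest independent subset of [B] has a span that is flat and contains [B], hence everything,
    so no independent set can augment it. *)
Lemma mrank_le_span (B : {set 'I_n}) :
  (forall F, flat C F -> B \subset F -> F = setT) -> (mrank C setT <= #|B|)%N.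
Proof.
move=> Bspan; pose P (I : {set 'I_n}) := indep C I && (I \subset B).
have P0 : P set0 by rewrite /P indep0 // sub0set.
case: (@arg_maxnP _ set0 P (fun I : {set 'I_n} => #|I|) P0) => I /andP[iI IB] max.
have [I' /andP[iI' _] <-] := mrank_attained ax setT.
apply: leq_trans (subset_leq_card IB); rewrite leqNgt; apply/negP => gt.
have [x /setDP[_ xI] ix] := indep_augment ax iI iI' gt.
suff e : [set e | (e \in I) || ~~ indep C (e |: I)] = setT.
  by have := in_setT x; rewrite -e inE (negbTE xI) ix.
apply: Bspan; first exact: span_flat.
apply/subsetP => y yB; rewrite inE; apply: contraT; rewrite negb_or negbK => /andP[yI iy].
have := max (y |: I); rewrite /P iy subUset sub1set yB IB => /(_ isT).
by rewrite cardsU1 yI /= add1n ltnn.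
Qed.
End SimpleMatroid.

(** * The incidence axioms for a good partition *)

Section GoodPartition.
Local Open Scope nat_scope.
Variables (n r : nat) (C : {set {set 'I_n}}) (blk : 'I_n -> 'I_r).
Hypotheses (ax : circuit_axioms C) (simple : simple_matroid C).
Hypotheses (rk : mrank C setT = r) (part : good_partition C blk).
Notation col := (collinear C).

(* If [k] were alone in its block at the top of [X], a transversal of the other blocks
   would already span, contradicting that the rank is the number of blocks. *)
Lemma circuit_top X k : X \in C -> k \in X ->
  exists2 k', k' \in X & (k' != k) && (blk k <= blk k')%N.
Proof.
move=> XC kX; apply/exists_inP; apply: contraT; rewrite negb_exists_in => /forall_inP low.
have lowX x : x \in X :\ k -> (blk x < blk k)%N.
  by rewrite !inE => /andP[xk /low]; rewrite xk /= -ltnNge.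
have [surj part2] := part.
pose b p := odflt k [pick x | blk x == p].
have bE p : blk (b p) = p.
  rewrite /b; case: pickP => [x /eqP//|/= none].
  by have [x e] := surj p; have := none x; rewrite e eqxx.
pose B := [set b p | p in [set~ blk k]].
have : (mrank C setT <= #|B|)%N.
  apply: mrank_le_span => // F fF BF; apply/eqP; rewrite -subTset; apply/subsetP => x _.
  have IH m : forall y, blk y = m :> nat -> y \in F.
    elim/ltn_ind: m => m IH y ym.
    have {}IH z : (blk z < blk y)%N -> z \in F by rewrite ym => lt; apply: (IH (blk z)).
    have [by_|by_] := eqVneq (blk y) (blk k).
      have kF : k \in F.
        have /flatP H := fF; apply: (H X) => //.
        by apply/subsetP => z /lowX; rewrite -by_ => /IH.
      have [->//|ky] := eqVneq y k.
      rewrite eq_sym in ky; have [i [lti cc]] := part2 _ _ ky (esym by_).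
      by apply: flat_col cc (IH i _) kF => //; rewrite by_.
    have bF : b (blk y) \in F.
      by apply: (subsetP BF); apply/imsetP; exists (blk y); rewrite // !inE.
    have [->//|ne] := eqVneq y (b (blk y)).
    rewrite eq_sym in ne; have [i [lti cc]] := part2 _ _ ne (bE _).
    by apply: flat_col cc (IH i _) bF => //; rewrite bE in lti.
  exact: (IH (blk x)).
rewrite rk leqNgt (leq_ltn_trans (leq_imset_card _ _)) //.
by rewrite cardsC1 card_ord; case: (r) (blk k) => [[]|].
Qed.

(** For [col_pasch], eliminating [l] and then [m] from the three given lines leaves a circuit inside
    [k, j, h, h']; there [k] would be alone in the top block, so [circuit_top] removes it. *)
Lemma good_plane : plane_axioms blk col.
Proof.
have [surj part2] := part; split.
- exact: collinear_rot.
- exact: collinear_swap.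
- exact: collinear_irr.
- exact: collinear_trans.
- move=> a b ne e; have [i [lti cc]] := part2 a b ne e; by exists i.
- move=> a b c cc; apply/negP => /andP[lb lc].
  have [|x] := circuit_top cc (k := a); first by rewrite !inE eqxx.
  rewrite !inE => /orP[/orP[]|]/eqP-> /andP[]; first by rewrite eqxx.
    by rewrite leqNgt lb.
  by rewrite leqNgt lc.
move=> j h h' k l m ekl elm lj lh lh' cP1 cP2 cP3 jh hh'.
have neb x y : (blk x < blk k)%N -> blk y = blk k -> (x == y) = false.
  by move=> lt e; apply: contraTF lt => /eqP->; rewrite e ltnn.
have bl : blk l = blk k by []. have bm : blk m = blk k by rewrite -elm.
have km : k == m = false.
  apply: contraTF cP2 => /eqP->. by rewrite collinear_rot collinear_irr.
have lm : l == m = false.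
  apply: contraTF cP3 => /eqP->. by rewrite collinear_rot collinear_irr.
have kl : k == l = false.
  apply: contraTF cP1 => /eqP->. by rewrite collinear_rot collinear_irr.
have [Y YC sY] : exists2 Y, Y \in C & Y \subset ([set j; k; l] :|: [set h'; l; m]) :\ l.
  apply: circuit_elim; rewrite ?inE ?eqxx ?orbT //.
  apply: contraFneq km => e; have /setP/(_ m) := e; rewrite !inE eqxx !orbT.
  by rewrite [m == j]eq_sym (neb j m) // [m == l]eq_sym lm orbF [m == k]eq_sym.
have sY' x : x \in Y -> [|| x == j, x == k, x == h' | x == m].
  move/(subsetP sY); rewrite !inE => /andP[/negbTE->]; rewrite !orbF /=.
  by rewrite -!orbA.
have notk X : X \in C -> (forall x, x \in X -> x != k -> (blk x < blk k)%N) -> k \notin X.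
  move=> XC low; apply/negP => /(circuit_top XC)[y /low lowy /andP[yk]].
  by rewrite leqNgt lowy.
(* Without [m] the point [k] would be alone on top of [Y], leaving only [j] and [h'], too few for a
   circuit. *)
have mY : m \in Y.
  apply: contraT => mY; case/negP: (small_circuit2 simple j h' YC).
  have kY : k \notin Y.
    apply: notk => // x xY xk; have := sY' x xY; rewrite (negbTE xk) /=.
    case/or3P=> [/eqP->//|/eqP->//|/eqP xm]; by rewrite xm in xY; rewrite xY in mY.
  apply/subsetP => x xY; have := sY' x xY; rewrite !inE.
  case/or4P=> [->//|/eqP xk|->|/eqP xm]; rewrite ?orbT //.
    by rewrite xk in xY; rewrite xY in kY.
  by rewrite xm in xY; rewrite xY in mY.
have hY : h \notin Y.
  apply/negP => /sY'; rewrite eq_sym (negbTE jh) (negbTE hh') !neb //.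
have [Z ZC sZ] : exists2 Z, Z \in C & Z \subset (Y :|: [set h; k; m]) :\ m.
  apply: circuit_elim => //; rewrite ?inE ?eqxx ?orbT //.
  by apply: contraNneq hY => ->; rewrite !inE eqxx.
have sZ' x : x \in Z -> [|| x == k, x == j, x == h | x == h'].
  move/(subsetP sZ); rewrite !inE => /andP[/negbTE xm]; rewrite xm orbF.
  case/or3P=> [/sY'|->|->]; rewrite ?orbT // xm orbF => /or3P[]->; rewrite ?orbT //.
have kZ : k \notin Z.
  apply: notk => // x xZ xk; have := sZ' x xZ; rewrite (negbTE xk) /=.
  by case/or3P=> /eqP->.
apply: (small_circuit simple ZC); apply/subsetP => x xZ; have := sZ' x xZ.
rewrite !inE; case: (eqVneq x k) => [xk|_] /=; first by rewrite xk (negbTE kZ) in xZ.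
by rewrite orbA orbAC.
Qed.
End GoodPartition.

(** * Quadratic duals of algebras presented by circuits *)

Lemma enum_setD1 n (X : {set 'I_n}) a : enum (X :\ a) = [seq b <- enum X | b != a].
Proof.
rewrite -filter_predI; apply: eq_filter => b; by rewrite !inE.
Qed.

Section QuadraticDual.
Variables (K : fieldType) (n : nat) (C : {set {set 'I_n}}).
Hypotheses (ax : circuit_axioms C) (simple : simple_matroid C).
Notation col := (collinear C).
Variables (s : K) (c : 'I_n -> 'I_n -> K).
Hypothesis sgn : sign_axioms col s c.
Variables (I : Type) (isrel : I -> Prop) (supp : I -> {set 'I_n}) (coef : I -> 'I_n -> K).
Hypothesis supp_circuit : forall x, isrel x -> supp x \in C.
Hypothesis circuit_supp : forall X, X \in C -> exists2 x, isrel x & supp x = X.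
(** The pattern is Cramer's rule for three vectors in a plane, with [c] in place of the determinants
    and a scalar [kappa]. *)
Hypothesis coefE : forall x a b d, isrel x -> enum (supp x) = [:: a; b; d] ->
  exists kappa, [/\ kappa != 0, coef x a = kappa * c b d,
    coef x b = - (kappa * c a d) & coef x d = kappa * c a b].
Variable gens : ncpoly K n -> Prop.
Hypothesis gensP : forall g, gens g <->
  [\/ exists i, forall w, g w = mono K [:: i; i] w,
      exists i j, forall w, g w = mono K [:: i; j] w + s * mono K [:: j; i] w |
      exists2 x, isrel x & forall w, g w =
        \sum_(a in supp x) coef x a * (w == enum (supp x :\ a))%:R].

Implicit Types (p q g : ncpoly K n).

Lemma pair2E q p : pair2 q p = \sum_(x : 'I_n * 'I_n) q [:: x.1; x.2] * p [:: x.1; x.2].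
Proof. by rewrite /pair2 pair_big. Qed.

Lemma pair2_word q (u : word n) : homog2 q -> pair2 q (fun w => (w == u)%:R) = q u.
Proof.
move=> hq; rewrite pair2E.
have [qu|qu] := eqVneq (q u) 0.
  rewrite qu big1 // => x _; case: eqVneq => [->|_]; last by rewrite mulr0.
  by rewrite qu mul0r.
have := hq u qu; case: u qu => [|a [|b []]] // _ _.
rewrite (bigD1 (a, b)) //= eqxx mulr1 big1 ?addr0 // => -[x y] /= ne.
case: eqVneq => [[ex ey]|_]; last by rewrite mulr0.
by rewrite ex ey eqxx in ne.
Qed.

Lemma pair2_ext q p p' : (forall a b, p [:: a; b] = p' [:: a; b]) -> pair2 q p = pair2 q p'.
Proof. by move=> e; rewrite !pair2E; apply: eq_bigr => x _; rewrite e. Qed.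

Lemma pair2_sum q (T : finType) (P : pred T) (x : T -> K) (p : T -> ncpoly K n) :
  pair2 q (fun w => \sum_(i | P i) x i * p i w) = \sum_(i | P i) x i * pair2 q (p i).
Proof.
rewrite pair2E; under eq_bigr => y _ do rewrite mulr_sumr.
rewrite exchange_big; apply: eq_bigr => i _ /=.
by rewrite pair2E mulr_sumr; apply: eq_bigr => y _; rewrite mulrCA.
Qed.

Lemma pair2_add q p p' (x : K) :
  pair2 q (fun w => p w + x * p' w) = pair2 q p + x * pair2 q p'.
Proof.
rewrite !pair2E mulr_sumr -big_split; apply: eq_bigr => y _ /=; ring.
Qed.

Lemma triple_circuit (X : {set 'I_n}) a b d : enum X = [:: a; b; d] -> X = [set a; b; d].
Proof.
by move=> e; apply/setP => y; rewrite -(mem_enum X) e !inE -orbA.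
Qed.

Lemma pair2_gen q x : homog2 q ->
  pair2 q (fun w => \sum_(a in supp x) coef x a * (w == enum (supp x :\ a))%:R) =
  \sum_(a <- enum (supp x)) coef x a * q [seq b <- enum (supp x) | b != a].
Proof.
move=> hq; rewrite pair2_sum big_enum /=; apply: eq_bigr => a _.
by rewrite pair2_word // enum_setD1.
Qed.

Lemma enum_supp3 x : size (enum (supp x)) = 3%N ->
  exists a b d, [/\ enum (supp x) = [:: a; b; d], a != b, a != d & b != d].
Proof.
have := enum_uniq (supp x); case: (enum _) => [|a [|b [|d []]]] //= + _.
rewrite !inE negb_or andbT => /andP[/andP[ab ad] bd].
by exists a, b, d.
Qed.

Lemma pair2_gen3 q x a b d : homog2 q -> enum (supp x) = [:: a; b; d] ->
  pair2 q (fun w => \sum_(a in supp x) coef x a * (w == enum (supp x :\ a))%:R) =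
  coef x a * q [:: b; d] + coef x b * q [:: a; d] + coef x d * q [:: a; b].
Proof.
move=> hq e; rewrite pair2_gen //; have := enum_uniq (supp x); rewrite e /=.
rewrite !inE negb_or andbT => /andP[/andP[ab ad] bd].
rewrite !big_cons big_nil addr0 !eqxx /= !(eq_sym b a, eq_sym d a, eq_sym d b).
by rewrite ab ad bd /= addrA.
Qed.

(** Circuits have at least three elements, so a multiple of a generator by a nonempty word never
    reaches degree two. *)
Lemma gen_degree g w : gens g -> g w != 0 -> (1 < size w)%N.
Proof.
case/gensP=> [[i e]|[i [j e]]|[x rx e]]; rewrite e /mono.
- by case: (eqVneq w [:: i; i]) => [->//|_]; rewrite eqxx.
- case: (eqVneq w [:: i; j]) => [->//|_]; case: (eqVneq w [:: j; i]) => [->//|_].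
  by rewrite mulr0 addr0 eqxx.
apply: contraNT => le; rewrite big1 // => a aX.
case: (eqVneq w (enum _)) le => [->|_ _]; last by rewrite mulr0.
rewrite -cardE; have := simple (supp_circuit rx).
by rewrite (cardsD1 a) aX add1n ltnS => ->.
Qed.

(** The quadratic part of the ideal comes from the squares, the commutation rules and the
    three-element circuits, and these give the three clauses of [dual_form] in turn. *)
Lemma dual_gensP q : dual_gens gens q <-> homog2 q /\ dual_form col s c (fun a b => q [:: a; b]).
Proof.
have ss := sign_ss sgn.
have sw a b : (fun a b => q [:: a; b]) a b = - s * q [:: b; a] -> a != b ->
    c b a * q [:: b; a] = - (c a b * q [:: a; b]).
  move=> /= -> ab; rewrite (sign_sym sgn ab).
  transitivity (s * s * (c b a * q [:: b; a])); last ring.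
  by rewrite ss mul1r.
split=> [[hq orth]|[hq [d1 d2 d3]]].
  have orth' g : gens g -> homog2 g -> pair2 q g = 0.
    by move=> gg hg; apply: orth; split=> //; apply: ideal_ext (ideal_gen [::] [::] gg) => w;
       have := shift_cat [::] g [::] w; rewrite /= cats0.
  have anti a b : q [:: a; b] = - s * q [:: b; a].
    have := orth' (fun w => mono K [:: a; b] w + s * mono K [:: b; a] w).
    rewrite pair2_add !pair2_word // => H; apply/eqP; rewrite -subr_eq0 mulNr opprK H //.
      by apply/gensP; constructor 2; exists a, b.
    move=> w; rewrite /mono; case: (eqVneq w [:: a; b]) => [->//|_].
    by case: (eqVneq w [:: b; a]) => [->//|_]; rewrite mulr0 addr0 eqxx.
  split=> //; split=> //.
    move=> a; have <- := pair2_word [:: a; a] hq; apply: orth'.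
      by apply/gensP; constructor 1; exists a.
    by move=> w; case: (eqVneq w [:: a; a]) => [->//|_]; rewrite eqxx.
  (* A generator yields the cocycle condition only for its support in increasing order; [Trot] and
     [Tswap] carry it to the other orders. *)
  pose T x y z := c x y * q [:: x; y] + c y z * q [:: y; z] + c z x * q [:: z; x] = 0.
  have Trot x y z : T x y z -> T y z x by rewrite /T => <-; ring.
  have Tswap x y z : x != y -> x != z -> y != z -> T x y z -> T y x z.
    rewrite /T => xy xz yz; rewrite (sw x y) // (sw z x) // 1?eq_sym // (sw y z) // => e.
    by rewrite -[RHS]oppr0 -e; ring.
  move=> x y z cxyz; rewrite -/(T x y z).
  have [g rg eg] := circuit_supp cxyz.
  have card3 : size (enum (supp g)) = 3%N.
    by rewrite -cardE; apply/eqP; rewrite eqn_leq (simple (supp_circuit rg)) eg cards3.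
  have [a [b [d [e ab ad bd]]]] := enum_supp3 card3.
  have Tabd : T a b d.
    have [kappa [k0 ea eb ed]] := coefE rg e.
    have := orth' (fun w => \sum_(a in supp g) coef g a * (w == enum (supp g :\ a))%:R).
    rewrite (pair2_gen3 hq e) ea eb ed => H.
    have {}H : kappa * (c b d * q [:: b; d] + - (c a d * q [:: a; d]) + c a b * q [:: a; b]) = 0.
      rewrite -[RHS]H; [ring | by apply/gensP; constructor 3; exists g |].
      move=> w w2; apply/eqP; apply: contraNT w2 => ne; rewrite big1 // => i iX.
      case: (eqVneq w (enum (supp g :\ i))) => [ew|_]; last by rewrite mulr0.
      case/negP: ne; rewrite ew -cardE; have := cardsD1 i (supp g).
      by rewrite iX cardE card3 add1n => -[<-].
    move/eqP: H; rewrite mulf_eq0 (negbTE k0) -(sw a d) // => /eqP.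
    by rewrite /T => <-; ring.
  have X3 := triple_circuit e; rewrite eg in X3.
  have [hx hy hz] : [/\ x \in [set a; b; d], y \in [set a; b; d] & z \in [set a; b; d]].
    by rewrite -X3 !inE !eqxx !orbT.
  have xy : x != y by apply: contraTneq cxyz => ->; rewrite collinear_irr.
  have yz : y != z by apply: contraTneq cxyz => ->; rewrite collinear_rot collinear_irr.
  have xz : x != z by apply: contraTneq cxyz => ->;
    rewrite collinear_rot collinear_rot collinear_irr.
  have ba : b != a by rewrite eq_sym. have da : d != a by rewrite eq_sym.
  have db : d != b by rewrite eq_sym.
  have T1 := Trot _ _ _ Tabd. have T2 := Trot _ _ _ T1.
  have T3 := Tswap _ _ _ ab ad bd Tabd. have T4 := Trot _ _ _ T3. have T5 := Trot _ _ _ T4.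
  move: hx hy hz xy yz xz; rewrite !inE.
  by case/orP=> [/orP[]|]/eqP->; case/orP=> [/orP[]|]/eqP->; case/orP=> [/orP[]|]/eqP->;
     rewrite ?eqxx.
have gen0 g : gens g -> pair2 q g = 0.
  case/gensP=> [[i e]|[i [j e]]|[x rx e]].
  - by rewrite (pair2_ext q (p' := fun w => (w == [:: i; i])%:R)) ?pair2_word //.
  - rewrite (pair2_ext q (p' := fun w => mono K [:: i; j] w + s * mono K [:: j; i] w)) //.
    by rewrite pair2_add !pair2_word // d2 mulNr addNr.
  transitivity (pair2 q (fun w => \sum_(a in supp x) coef x a * (w == enum (supp x :\ a))%:R)).
    by apply: pair2_ext => a b; rewrite e.
  have [card3|ncard3] := eqVneq (size (enum (supp x))) 3%N.
    have [a [b [d [ee ab ad bd]]]] := enum_supp3 card3.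
    have [kappa [k0 ea eb ed]] := coefE rx ee.
    rewrite (pair2_gen3 hq ee) ea eb ed.
    have cabd : col a b d by rewrite /collinear -(triple_circuit ee) supp_circuit.
    have := d3 _ _ _ cabd; rewrite /= (sw a d) // => e0.
    by rewrite -[RHS](mulr0 kappa) -{1}e0; ring.
  rewrite pair2_gen // big1_seq // => a /= aX.
  have [->|/hq sz] := eqVneq (q [seq b <- enum (supp x) | b != a]) 0; first by rewrite mulr0.
  case/eqP: ncard3; move: sz; rewrite -enum_setD1 -!cardE => sz.
  by rewrite (cardsD1 a) -(mem_enum (supp x)) aX sz.
split=> // p [[m [x [a [b [g [Gg E]]]]]] _].
transitivity (pair2 q (fun w => \sum_i x i * shift (a i) (g i) (b i) w)).
  by apply: pair2_ext => i j; rewrite E.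
rewrite pair2_sum big1 // => k _.
have [/andP[/eqP-> /eqP->]|nab] := boolP ((a k == [::]) && (b k == [::])).
  by rewrite (pair2_ext q (p' := g k)) ?gen0 ?mulr0.
rewrite pair2E big1 ?mulr0 // => y _.
have [->|] := eqVneq (shift (a k) (g k) (b k) [:: y.1; y.2]) 0.
  by rewrite mulr0.
case/shift_supp => u /(congr1 size); rewrite !size_cat /= => sz gu.
have gt := gen_degree (Gg k) gu; case/negP: nab.
rewrite -!size_eq0; move: sz gt; move: (size (a k)) (size (b k)) (size u) => na nb nu; lia.
Qed.
End QuadraticDual.

(** * From the dual ideal to the two families of relations *)

Section Assembly.
Variables (K : fieldType) (n r : nat) (C : {set {set 'I_n}}) (blk : 'I_n -> 'I_r).
Hypotheses (ax : circuit_axioms C) (simple : simple_matroid C).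
Hypotheses (rk : mrank C setT = r) (part : good_partition C blk).
Notation col := (collinear C).
Variables (s : K) (c : 'I_n -> 'I_n -> K).
Hypothesis sgn : sign_axioms col s c.
Variable D : ncpoly K n -> Prop.
Hypothesis DP : forall q, D q <-> homog2 q /\ dual_form col s c (fun a b => q [:: a; b]).
Variables (rho_flat : {set 'I_n} -> 'I_n -> ncpoly K n) (rho : 'I_n -> 'I_n -> ncpoly K n).
Hypothesis rho_flatE : forall F j, rank2flat C F -> j \in F ->
  rho_flat F j =1 line_rel s c (fun k => (k \in F) && (k != j)) j.
Hypothesis rhoE : forall j i, (blk i < blk j)%N -> rho j i =1 retro_rel col s c j i.

Let plane := good_plane ax simple rk part.

Lemma flat_rel_dual F j : rank2flat C F -> j \in F ->
  D (line_rel s c (fun k => (k \in F) && (k != j)) j).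
Proof.
move=> rF jF; apply/DP; split; first exact: line_rel_homog2.
apply: (line_rel_dual plane sgn) => [h /andP[]//|y z cc].
have [jy jz _] := col_neq plane cc; rewrite ![_ == j]eq_sym jy jz !andbT.
have [fF _] := rF; apply/idP/idP => H; first exact: flat_col fF cc jF H.
by apply: flat_col fF _ jF H; rewrite (col_swap23 plane).
Qed.

Lemma matroid_conclusions : let J := ideal D in
  [/\ groebner (word_lt blk) (fun g => exists F j, [/\ rank2flat C F, j \in F &
                              forall w, g w = rho_flat F j w]) J,
      reduced_groebner (word_lt blk) (fun g => exists j i, retrograde blk j i /\
                              forall w, g w = rho j i w) J,
      (forall j i, retrograde blk j i -> is_lm (word_lt blk) (rho j i) [:: j; i]) &
      common_conclusions blk (word_lt blk) J].
Proof.
move=> J; split; last exact: (quadratic_conclusions plane sgn DP).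
- apply: (groebner_of plane sgn DP) => [g [F [j [rF jF e]]]|j i lt].
    apply: (@ideal_ext _ _ _ (line_rel s c (fun k => (k \in F) && (k != j)) j)) => [w|].
      by rewrite e rho_flatE.
    by apply: (dual_ideal (D := D)); apply: flat_rel_dual.
  have ji : j != i by apply: contraTneq lt => ->; rewrite ltnn.
  pose F := [set k | mem_line C j i k].
  have rF : rank2flat C F by apply: rank2_line.
  have jF : j \in F by rewrite inE /mem_line eqxx.
  exists (rho_flat F j); first by exists F, j.
  have [e1 [_ lm]] := retro_rel_lm plane sgn lt.
  have cc := sign_sq sgn ji.
  (* The relation of a flat at [j] is that of any retrograde pair [(j, i)] in it, up to the unit
     [c j i]; hence it has the same leading word. *)
  have E w : rho_flat F j w = c j i * retro_rel col s c j i w.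
    rewrite rho_flatE // /retro_rel mulrA cc mul1r; apply: eq_bigl => k.
    rewrite inE /mem_line /punctured.
    have [->|kj] := eqVneq k j; last by rewrite andbT collinear_swap.
    rewrite andbF (negbTE ji); apply/esym/negP => h.
    by have [_] := col_neq plane h; rewrite eqxx.
  split=> [|u]; rewrite E; first (rewrite e1 mulr1; apply/eqP => c0).
    by move: cc; rewrite c0 mul0r => /esym/eqP; rewrite oner_eq0.
  by rewrite mulf_eq0 negb_or => /andP[_]; apply: lm.
- by apply: (reduced_retro plane sgn DP rhoE) => g; split.
move=> j i lt; have [_ lm] := retro_rel_lm plane sgn lt.
by apply: is_lm_ext lm => w; rewrite rhoE.
Qed.

Lemma sum_punctured (V : nmodType) (X : 'I_n -> V) j i : (blk i < blk j)%N ->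
  \sum_(h | punctured col j i h) X h =
  X i + \sum_(k in mjoin C [set j] [set i] | (k != i) && (k != j)) X k.
Proof.
move=> lt; have ji : j != i by apply: contraTneq lt => ->; rewrite ltnn.
rewrite (bigD1 i) /=; last by rewrite /punctured eqxx.
congr (_ + _); apply: eq_bigl => k; rewrite line_closure // inE /mem_line /punctured.
have [//|ki] := eqVneq k i; first by rewrite andbF andbF.
rewrite andbT /=; have [->|kj] := eqVneq k j; last by rewrite andbT collinear_swap.
rewrite andbF; apply/negP => h.
by have [_] := col_neq plane h; rewrite eqxx.
Qed.
End Assembly.

(** * The Orlik-Solomon case *)

Section OrlikSolomon.
Variables (K : fieldType) (n r : nat) (C : {set {set 'I_n}}) (blk : 'I_n -> 'I_r).
Hypotheses (ax : circuit_axioms C) (simple : simple_matroid C).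
Hypotheses (rk : mrank C setT = r) (part : good_partition C blk).

Lemma os_sign : sign_axioms (collinear C) (1 : K) (fun _ _ => 1).
Proof. by split=> *; rewrite ?mulr1. Qed.

Lemma os_dual q : dual_gens (OS_gens K C) q <->
  homog2 q /\ dual_form (collinear C) (1 : K) (fun _ _ => 1) (fun a b => q [:: a; b]).
Proof.
apply: (@dual_gensP _ _ _ simple _ _ os_sign {set 'I_n} (fun X => X \in C) id
  (fun X a => (-1) ^+ index a (enum X))) => //.
- by move=> X XC; exists X.
(* The boundary signs on a triple are 1, -1, 1, already the required pattern. *)
- move=> X a b d XC /= e; exists 1; have := enum_uniq X; rewrite e /=.
  rewrite !inE negb_or andbT => /andP[/andP[ab ad] bd]; rewrite oner_neq0 !eqxx.
  by rewrite (negbTE ab) (negbTE ad) (negbTE bd) /= expr0 expr1 sqrrN expr1n !mulr1.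
move=> g; split; case=> [[i e]|[i [j e]]|[X XC e]];
  [constructor 1; by exists i | constructor 2; exists i, j | constructor 3; by exists X |
   constructor 1; by exists i | constructor 2; exists i, j | constructor 3; by exists X];
  by move=> w; rewrite e mul1r.
Qed.

Lemma os_conclusions : let J := koszul_dual_ideal (OS_gens K C) in
  [/\ groebner (word_lt blk) (fun g => exists F j, [/\ rank2flat C F, j \in F &
                              forall w, g w = r_flat K F j w]) J,
      reduced_groebner (word_lt blk) (fun g => exists j i, retrograde blk j i /\
                              forall w, g w = r_retro K C j i w) J,
      (forall j i, retrograde blk j i -> is_lm (word_lt blk) (r_retro K C j i) [:: j; i]) &
      common_conclusions blk (word_lt blk) J].
Proof.
apply: (matroid_conclusions ax simple rk part os_sign os_dual).
- by move=> F j _ _ w; apply: eq_bigr => k _; rewrite !mul1r.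
move=> j i lt w; rewrite /retro_rel /line_rel (sum_punctured ax simple rk part) // !mul1r.
by congr (_ + _); apply: eq_bigr => k _; rewrite !mul1r.
Qed.
End OrlikSolomon.

(** * Signs in oriented matroids *)

Section OrientedMatroid.
Variables (n : nat) (SC : {set signed n}).
Hypothesis om : om_axioms SC.
Notation C := (underlying SC).
Notation col := (collinear C).

Lemma underlyingP Y : reflect (exists2 X, X \in SC & ssupp X = Y) (Y \in C).
Proof. by apply: (iffP imsetP) => [[X XS ->]|[X XS <-]]; exists X. Qed.

Lemma ssupp_sneg (X : signed n) : ssupp (sneg X) = ssupp X.
Proof. by rewrite /ssupp setUC. Qed.

Lemma in_ssupp (X : signed n) a : (a \in ssupp X) = (a \in X.1) || (a \in X.2).
Proof. by rewrite inE. Qed.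

Lemma signed_disj X a : X \in SC -> a \in X.1 -> a \in X.2 -> False.
Proof.
case: om => H _ _ _ /H[e _] a1 a2; have : a \in X.1 :&: X.2 by rewrite inE a1.
by rewrite e inE.
Qed.

Lemma signed2 X a : X \in SC -> a \in ssupp X -> (a \in X.2) = (a \notin X.1).
Proof.
move=> XS; rewrite in_ssupp; case: (boolP (a \in X.1)) => //= a1 _.
by apply/negP; apply: signed_disj a1.
Qed.

(** Signs are read as membership in the positive part, which makes the axiom symmetric in [X] and
    [Y]: each element of [Z] inherits its sign from a circuit containing it. *)
Lemma signed_elim X Y e : X \in SC -> Y \in SC -> ssupp X != ssupp Y ->
  e \in ssupp X -> e \in ssupp Y -> (e \in X.1) != (e \in Y.1) ->
  exists2 Z, Z \in SC & forall a, a \in ssupp Z -> a != e /\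
    (a \in ssupp X /\ (a \in Z.1) = (a \in X.1) \/ a \in ssupp Y /\ (a \in Z.1) = (a \in Y.1)).
Proof.
move=> XS YS ne eX eY sg.
have [Z ZS [s1 s2]] : exists2 Z, Z \in SC & (Z.1 \subset (X.1 :|: Y.1) :\ e) /\
    (Z.2 \subset (X.2 :|: Y.2) :\ e).
  case: om => _ _ _ H; case: (boolP (e \in X.1)) (sg) => [e1 n1|n1 e1].
    apply: H => //; last by rewrite inE e1 signed2 //; case: (e \in Y.1) n1.
    by apply: contraNneq ne => ->; rewrite ssupp_sneg.
  rewrite [X.1 :|: _]setUC [X.2 :|: _]setUC.
  apply: H => //; last by rewrite inE signed2 // n1; case: (e \in Y.1) e1.
  by apply: contraNneq ne => ->; rewrite ssupp_sneg.
exists Z => // a; rewrite in_ssupp; case: (boolP (a \in Z.1)) => [a1 _|n1 /= a2].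
  have := subsetP s1 a a1; rewrite !inE => /andP[-> /orP[]a']; split=> //; [left|right];
    by rewrite a'.
have := subsetP s2 a a2; rewrite !inE => /andP[-> /orP[]a']; split=> //; [left|right].
  by rewrite a' orbT; split=> //; apply/esym/negP => /(signed_disj XS)/(_ a').
by rewrite a' orbT; split=> //; apply/esym/negP => /(signed_disj YS)/(_ a').
Qed.

Lemma underlying_circuits : circuit_axioms C.
Proof.
have [h1 h2 h3 _] := om; split.
- by apply/negP => /underlyingP[X /h1[_ ne] e]; rewrite e eqxx in ne.
- move=> _ _ /underlyingP[X XS <-] /underlyingP[Y YS <-] sub.
  by case: (h3 X Y XS YS sub) => ->; rewrite ?ssupp_sneg.
move=> _ _ e /underlyingP[X XS <-] /underlyingP[Y YS <-] ne; rewrite inE => /andP[eX eY].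
(* Negating [Y] if necessary gives [e] opposite signs, as signed elimination demands. *)
have [Y' [YS' sY sg]] : exists Y', [/\ Y' \in SC, ssupp Y' = ssupp Y & (e \in X.1) != (e \in Y'.1)].
  have [eq|ne'] := eqVneq (e \in X.1) (e \in Y.1); last by exists Y.
  exists (sneg Y); split; [exact: h2 | exact: ssupp_sneg |].
  by rewrite /= signed2 // eq; case: (e \in Y.1).
rewrite -sY in ne eY *; have [Z ZS HZ] := signed_elim XS YS' ne eX eY sg.
exists (ssupp Z); first by apply/underlyingP; exists Z.
by apply/subsetP => a /HZ[ae []] [aX _]; rewrite in_setD1 ae in_setU aX ?orbT.
Qed.

Hypothesis simple : simple_matroid C.

Lemma signed_normalize X a b : X \in SC -> a \in ssupp X ->
  exists X', [/\ X' \in SC, ssupp X' = ssupp X, (a \in X'.1) = b &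
    forall x, x \in ssupp X -> (x \in X'.1) (+) (a \in X'.1) = (x \in X.1) (+) (a \in X.1)].
Proof.
move=> XS aX; have [e|ne] := eqVneq (a \in X.1) b; first by exists X.
exists (sneg X); have [_ h2 _ _] := om; split; [exact: h2 | exact: ssupp_sneg | |].
  by rewrite /= signed2 //; case: (a \in X.1) b ne => [] [].
by move=> x xX /=; rewrite !signed2 //; case: (x \in X.1); case: (a \in X.1).
Qed.

Ltac colC := first [assumption | rewrite collinear_rot; assumption
  | rewrite collinear_rot collinear_rot; assumption | rewrite collinear_swap; assumption
  | rewrite collinear_rot collinear_swap; assumption
  | rewrite collinear_swap collinear_rot; assumption].

Let ax := underlying_circuits.

Lemma signed_of_col a b d : col a b d -> exists2 X, X \in SC & ssupp X = [set a; b; d].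
Proof. by move/underlyingP. Qed.

Lemma col_distinct a b d : col a b d -> [/\ a != b, a != d & b != d].
Proof.
move=> cc; split; apply: contraTneq cc => ->.
- by rewrite (collinear_irr simple).
- by rewrite collinear_rot collinear_rot (collinear_irr simple).
- by rewrite collinear_rot (collinear_irr simple).
Qed.

Section Quadrilateral.
Variables (j h h' k l m : 'I_n).
Hypotheses (cG : col j h h') (cL : col j k l) (cP : col h k m) (cQ : col h' l m).
Hypothesis njhk : ~~ col j h k.

(* Eliminating first the vertex [h'] and then [j] transports the signs of the lines
   through them to the fourth side of the quadrilateral. *)
Lemma quad_elim XG XQ XL : XG \in SC -> XQ \in SC -> XL \in SC ->
  ssupp XG = [set j; h; h'] -> ssupp XQ = [set h'; l; m] -> ssupp XL = [set j; k; l] ->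
  (h' \in XG.1) != (h' \in XQ.1) -> (j \in XG.1) != (j \in XL.1) ->
  exists Z, [/\ Z \in SC, ssupp Z = [set h; k; m],
    (h \in Z.1) = (h \in XG.1) & (m \in Z.1) = (m \in XQ.1)].
Proof.
move=> GS QS LS sG sQ sL ne1 ne2.
have [jh jh' hh'] := col_distinct cG; have [jk jl kl] := col_distinct cL.
have [hk hm km] := col_distinct cP; have [h'l h'm lm] := col_distinct cQ.
have ctr a b d e := @collinear_trans _ _ ax simple a b d e.
have jm : j != m by apply: contraNneq njhk => e; move: cP; rewrite -e => ?; colC.
have hl : h != l by apply: contraNneq njhk => e; move: cL; rewrite -e => ?; colC.
have h'k : h' != k by apply: contraNneq njhk => e; move: cG; rewrite e => ?; colC.
have nhkl : ~~ col h k l.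
  apply: contra njhk => c1; have c2 : col k l h by colC.
  have c3 : col k l j by colC.
  have := ctr _ _ _ _ c2 c3; rewrite eq_sym => /(_ jh) c9; colC.
have nklm : ~~ col k l m.
  apply: contra nhkl => c1; have c2 : col k m l by colC.
  have c3 : col k m h by colC.
  have := ctr _ _ _ _ c2 c3; rewrite eq_sym => /(_ hl) c4; colC.
have nhlm : ~~ col h l m.
  apply: contra nhkl => c1; have c2 : col h m l by colC.
  have c3 : col h m k by colC.
  have := ctr _ _ _ _ c3 c2 kl => c4; colC.
have nesym (a b : 'I_n) : a != b -> (b == a) = false by rewrite eq_sym => /negbTE.
have E := (negbTE jh, negbTE jh', negbTE hh', negbTE jk, negbTE jl, negbTE kl,
  (negbTE hk, negbTE hm, negbTE km, negbTE h'l, negbTE h'm, negbTE lm),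
  (negbTE jm, negbTE hl, negbTE h'k),
  (nesym _ _ jh, nesym _ _ jh', nesym _ _ hh', nesym _ _ jk, nesym _ _ jl, nesym _ _ kl),
  (nesym _ _ hk, nesym _ _ hm, nesym _ _ km, nesym _ _ h'l, nesym _ _ h'm, nesym _ _ lm),
  (nesym _ _ jm, nesym _ _ hl, nesym _ _ h'k)).
have [] := @signed_elim XG XQ h' GS QS; rewrite ?sG ?sQ ?inE ?eqxx ?orbT //.
  by apply/eqP => /setP/(_ j); rewrite !inE !E eqxx.
move=> W WS HW.
have WC : ssupp W \in C by apply/underlyingP; exists W.
have sW : forall a, a \in ssupp W -> [|| a == j, a == h, a == l | a == m].
  move=> a /HW; rewrite !inE => -[/negbTE->] [] []; rewrite ?orbF /=.
    by case/orP=> ->; rewrite ?orbT.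
  by case/orP=> ->; rewrite ?orbT.
have jW : j \in ssupp W.
  apply: contraT => jW; case/negP: nhlm; apply: (small_circuit simple WC).
  apply/subsetP => a aW; have := sW a aW; rewrite !inE -orbA; case: eqVneq => //= e.
  by rewrite e (negbTE jW) in aW.
have kW : k \notin ssupp W by apply/negP => /sW; rewrite !E.
have jWG : (j \in W.1) = (j \in XG.1).
  by have [_ [[_ ->]//|[]]] := HW j jW; rewrite !inE !E.
have [] := @signed_elim W XL j WS LS; rewrite ?sL ?inE ?eqxx ?orbT ?jWG //.
- by apply: contraNneq kW => ->; rewrite !inE eqxx orbT.
- by rewrite -jWG -in_ssupp.
move=> Z ZS HZ.
have ZC : ssupp Z \in C by apply/underlyingP; exists Z.
have sZ : forall a, a \in ssupp Z -> [|| a == h, a == l, a == m | a == k].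
  move=> a /HZ[aj []] [].
    by move/sW; rewrite (negbTE aj) /= => + _ => /or3P[]->; rewrite ?orbT.
  by rewrite !inE (negbTE aj) /= => + _ => /orP[]->; rewrite ?orbT.
have cH : [set h; k; m] \in C by [].
(* With [l] in it, [Z] could not contain the circuit [h, k, m], so it would be one of three triples
   through [l], none of them collinear. *)
have lZ : l \notin ssupp Z.
  apply/negP => lZ.
  have miss : ~~ ([set h; k; m] \subset ssupp Z).
    apply/negP => /(circuit_incomparable ax cH ZC) e.
    by move: lZ; rewrite -e !inE !E.
  move: miss; rewrite !subUset !sub1set -andbA !negb_and => /or3P[hZ|kZ|mZ].
  - case/negP: nklm; apply: (small_circuit simple ZC); apply/subsetP => a aZ.
    have := sZ a aZ; rewrite !inE; case: (eqVneq a h) => [e|_]; first by rewrite -e aZ in hZ.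
    by move=> /= /or3P[] ->; rewrite ?orbT.
  - case/negP: nhlm; apply: (small_circuit simple ZC); apply/subsetP => a aZ.
    have := sZ a aZ; rewrite !inE; case: (eqVneq a k) => [e|_]; first by rewrite -e aZ in kZ.
    by rewrite orbF => /or3P[]->; rewrite ?orbT.
  case/negP: nhkl; apply: (small_circuit simple ZC); apply/subsetP => a aZ.
  have := sZ a aZ; rewrite !inE; case: (eqVneq a m) => [e|_]; first by rewrite -e aZ in mZ.
  by move=> /= /or3P[] ->; rewrite ?orbT.
have eZ : ssupp Z = [set h; k; m].
  apply: (circuit_incomparable ax) => //; apply/subsetP => a aZ; have := sZ a aZ.
  rewrite !inE; case: (eqVneq a l) => [e|_]; first by rewrite -e aZ in lZ.
  by move=> /= /or3P[] ->; rewrite ?orbT.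
have hZ : h \in ssupp Z by rewrite eZ !inE eqxx.
have mZ : m \in ssupp Z by rewrite eZ !inE eqxx !orbT.
exists Z; split=> //.
  have [_ [[hW ->]|[]]] := HZ h hZ; last by rewrite !inE !E.
  by have [_ [[_ ->]//|[]]] := HW h hW; rewrite ?sQ !inE !E.
have [_ [[mW ->]|[]]] := HZ m mZ; last by rewrite !inE !E.
by have [_ [[]|[_ ->]//]] := HW m mW; rewrite ?sG !inE !E.
Qed.

(** The triangle is [h, h', m] and the transversal [j, k, l]. Each exclusive or says whether two
    vertices have opposite signs on their side; an odd number of sides has this, as a line meets an
    even number of sides of a triangle internally. *)
Lemma signed_menelaus XG XP XQ : XG \in SC -> XP \in SC -> XQ \in SC ->
  ssupp XG = [set j; h; h'] -> ssupp XP = [set h; k; m] -> ssupp XQ = [set h'; l; m] ->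
  ((h \in XG.1) (+) (h' \in XG.1)) (+) ((h \in XP.1) (+) (m \in XP.1))
    (+) ((h' \in XQ.1) (+) (m \in XQ.1)).
Proof.
move=> GS PS QS sG sP sQ; have [XL LS sL] := signed_of_col cL.
have h'Q : h' \in ssupp XQ by rewrite sQ !inE eqxx.
have jL : j \in ssupp XL by rewrite sL !inE eqxx.
have [XQ' [QS' sQ' eQ HQ]] := signed_normalize (~~ (h' \in XG.1)) QS h'Q.
have [XL' [LS' sL' eL _]] := signed_normalize (~~ (j \in XG.1)) LS jL.
have [||Z [ZS sZ eh em]] := quad_elim GS QS' LS' sG (etrans sQ' sQ) (etrans sL' sL).
- by rewrite eQ; case: (_ \in _).
- by rewrite eL; case: (_ \in _).
have mQ : m \in ssupp XQ by rewrite sQ !inE eqxx !orbT.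
have := HQ m mQ; rewrite eQ -em [RHS]addbC => <-.
have [_ _ H _] := om.
have [hP mP] : h \in ssupp XP /\ m \in ssupp XP by rewrite sP !inE !eqxx !orbT.
have -> : (h \in XP.1) (+) (m \in XP.1) = (h \in Z.1) (+) (m \in Z.1).
  case: (H XP Z PS ZS) => [|->//|->/=]; first by rewrite sP sZ.
  by rewrite !signed2 //; case: (h \in XP.1); case: (m \in XP.1).
by rewrite eh; case: (h \in XG.1); case: (h' \in XG.1); case: (m \in Z.1).
Qed.
End Quadrilateral.
End OrientedMatroid.

(** * Signs of dependencies among plane vectors *)

Section Signs.
Variables (K : fieldType) (R : realFieldType).

Definition sgn_in (x : R) : K := if 0 < x then 1 else if x < 0 then -1 else 0.

Lemma sgn_inE x : sgn_in x = (sgz x)%:~R.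
Proof.
rewrite /sgn_in; have [x0|x0|->] := ltrgt0P x; rewrite ?sgz0 //.
  by rewrite gtr0_sgz.
by rewrite ltr0_sgz.
Qed.

Lemma sgn_inM x y : sgn_in (x * y) = sgn_in x * sgn_in y.
Proof. by rewrite !sgn_inE sgzM intrM. Qed.

Lemma sgn_inN x : sgn_in (- x) = - sgn_in x.
Proof. by rewrite !sgn_inE sgzN intrN. Qed.

Lemma sgn_in_sq x : x != 0 -> sgn_in x * sgn_in x = 1.
Proof. by rewrite /sgn_in; case: ltrgt0P => //= _ _; rewrite ?mulr1 ?mulrNN ?mulr1. Qed.

Lemma det2C (a b : R * R) : det2 a b = - det2 b a.
Proof. by rewrite /det2; ring. Qed.

Lemma chiE n (v : 'I_n -> R * R) j k : chi K v j k = sgn_in (det2 (v j) (v k)).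
Proof. by []. Qed.

Lemma sum_supp2 n (mu f : 'I_n -> R) a b : a != b ->
  (forall k, mu k != 0 -> k \in [set a; b]) -> \sum_k mu k * f k = mu a * f a + mu b * f b.
Proof.
move=> ab sup; rewrite (bigD1 a) // (bigD1 b) 1?eq_sym //= big1 ?addr0 // => k /andP[ka kb].
have [->|/sup] := eqVneq (mu k) 0; first by rewrite mul0r.
by rewrite !inE (negbTE ka) (negbTE kb).
Qed.

Lemma sum_supp3 n (mu f : 'I_n -> R) a b d : a != b -> a != d -> b != d ->
  (forall k, mu k != 0 -> k \in [set a; b; d]) ->
  \sum_k mu k * f k = mu a * f a + mu b * f b + mu d * f d.
Proof.
move=> ab ad bd sup; rewrite (bigD1 a) // (bigD1 b) 1?eq_sym //=.
rewrite (bigD1 d) /= 1?big1 ?addr0 ?addrA // => [k /andP[/andP[ka kb] kd]|].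
  have [->|/sup] := eqVneq (mu k) 0; first by rewrite mul0r.
  by rewrite !inE (negbTE ka) (negbTE kb) (negbTE kd).
by rewrite ![d == _]eq_sym ad bd.
Qed.

Definition lam_sign n (lam : 'I_n -> R) : signed n := ([set k | 0 < lam k], [set k | lam k < 0]).

Lemma ssupp_lam_sign n (lam : 'I_n -> R) k : (k \in ssupp (lam_sign lam)) = (lam k != 0).
Proof. by rewrite !inE; case: ltrgt0P. Qed.

Lemma vec_circuit_lam n (w : 'I_n -> R * R) (lam : 'I_n -> R) a : lam a != 0 ->
  \sum_k lam k * (w k).1 = 0 -> \sum_k lam k * (w k).2 = 0 ->
  (forall mu : 'I_n -> R, (forall k, mu k != 0 -> lam k != 0) ->
     \sum_k mu k * (w k).1 = 0 -> \sum_k mu k * (w k).2 = 0 ->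
     (exists2 k, lam k != 0 & mu k = 0) -> forall k, mu k = 0) ->
  vec_circuit w (lam_sign lam).
Proof.
move=> la s1 s2 mini; split.
- by apply/setP => k; rewrite !inE; case: ltrgt0P.
- by apply/set0Pn; exists a; rewrite ssupp_lam_sign.
- exists lam; split=> // k; rewrite ?inE //.
  by case: ltrgt0P.
move=> mu sup m1 m2 [k kX k0]; apply: mini => //.
  by move=> x /sup; rewrite ssupp_lam_sign.
by exists k => //; rewrite -ssupp_lam_sign.
Qed.

(** Either one of the vectors vanishes and is a loop, or they are parallel. In a simple matroid
    neither can occur, which is how determinants on a line are shown to be nonzero. *)
Lemma dependent_pair n (w : 'I_n -> R * R) a b : a != b -> det2 (w a) (w b) = 0 ->
  exists2 X, vec_circuit w X & ssupp X \subset [set a; b].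
Proof.
move=> ab det0.
have single x : w x = 0 -> x \in [set a; b] ->
    exists2 X, vec_circuit w X & ssupp X \subset [set a; b].
  move=> wx xab; pose lam k : R := (k == x)%:R.
  have lx k : lam k != 0 -> k = x by rewrite /lam; case: (eqVneq k x) => // _; rewrite eqxx.
  have sl f : f x = 0 -> \sum_k lam k * f k = 0.
    move=> fx; rewrite big1 // => k _; have [->|/lx->] := eqVneq (lam k) 0.
      by rewrite mul0r.
    by rewrite fx mulr0.
  exists (lam_sign lam); last by apply/subsetP => k; rewrite ssupp_lam_sign => /lx->.
  apply: (vec_circuit_lam (a := x)); rewrite ?sl ?wx //; first by rewrite /lam eqxx oner_neq0.
  move=> mu sup _ _ [k /lx-> mux] y; have [//|/sup/lx ->] := eqVneq (mu y) 0.
  by [].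
have [/single|wa] := eqVneq (w a) 0; first by apply; rewrite !inE eqxx.
have [/single|wb] := eqVneq (w b) 0; first by apply; rewrite !inE eqxx orbT.
have [t t0 [e1 e2]] : exists2 t, t != 0 & (w b).1 = t * (w a).1 /\ (w b).2 = t * (w a).2.
  case: (w a) (w b) wa wb det0 => [a1 a2] [b1 b2] /=; rewrite /det2 /= => wa wb /eqP.
  rewrite subr_eq0 => /eqP det0.
  have [a10|a10] := eqVneq a1 0.
    have a20 : a2 != 0 by apply: contraNneq wa => ->; rewrite a10.
    have b10 : b1 = 0.
      by move: det0; rewrite a10 mul0r => /esym/eqP; rewrite mulf_eq0 (negbTE a20) => /eqP.
    have b20 : b2 != 0 by apply: contraNneq wb => ->; rewrite b10.
    by exists (b2 / a2); [rewrite mulf_neq0 ?invr_eq0 | rewrite a10 b10 mulr0 divfK].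
  have b10 : b1 != 0.
    apply: contraNneq wb => b10; move: det0; rewrite b10 mulr0 => /eqP.
    by rewrite mulf_eq0 (negbTE a10) => /eqP->.
  exists (b1 / a1); first by rewrite mulf_neq0 ?invr_eq0.
  by rewrite divfK // mulrAC -[b1 * a2]mulrC -det0 mulrAC divff ?mul1r.
(* These are the coefficients of the dependency [w b - t * w a = 0]; both are nonzero, so it is
   minimal. *)
pose lam k := if k == a then - t else if k == b then 1 else 0.
have la : lam a = - t by rewrite /lam eqxx.
have lb : lam b = 1 by rewrite /lam eq_sym (negbTE ab) eqxx.
have lx k : lam k != 0 -> k \in [set a; b].
  by rewrite /lam !inE; case: (k == a) => //=; case: (k == b) => //; rewrite eqxx.
have l0 : lam a != 0 by rewrite la oppr_eq0.
exists (lam_sign lam); last by apply/subsetP => k; rewrite ssupp_lam_sign => /lx.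
apply: (vec_circuit_lam l0).
- by rewrite (sum_supp2 _ ab lx) la lb e1; ring.
- by rewrite (sum_supp2 _ ab lx) la lb e2; ring.
move=> mu sup; have sup' k : mu k != 0 -> k \in [set a; b] by move=> /sup/lx.
rewrite !(sum_supp2 _ ab sup') e1 e2 => m1 m2 [k /lx kab k0].
have m0 : mu a + mu b * t = 0.
  apply/eqP; apply: contraNT wa => ne; case: (w a) m1 m2 => [a1 a2] /= m1 m2.
  have f1 : (mu a + mu b * t) * a1 = 0 by rewrite -[RHS]m1; ring.
  have f2 : (mu a + mu b * t) * a2 = 0 by rewrite -[RHS]m2; ring.
  move/eqP: f1; rewrite mulf_eq0 (negbTE ne) => /= /eqP->.
  by move/eqP: f2; rewrite mulf_eq0 (negbTE ne) => /= /eqP->.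
have [ma mb] : mu a = 0 /\ mu b = 0.
  move: kab; rewrite !inE => /orP[]/eqP e; move: m0 k0; rewrite e => + h; rewrite h.
    by rewrite add0r => /eqP; rewrite mulf_eq0 (negbTE t0) orbF => /eqP.
  by rewrite mul0r addr0.
move=> y; have [//|/sup'] := eqVneq (mu y) 0.
by rewrite !inE => /orP[]/eqP->.
Qed.
End Signs.

(** * The Varchenko-Gelfand case *)

Section VarchenkoGelfand.
Variables (K : fieldType) (R : realFieldType) (n r : nat) (blk : 'I_n -> 'I_r).
Variables (SC : {set signed n}) (v : {set 'I_n} -> 'I_n -> R * R).
Hypothesis om : om_axioms SC.
Notation C := (underlying SC).
Notation col := (collinear C).
Hypothesis simple : simple_matroid C.
Hypothesis real : forall F, rank2flat C F -> realizes SC F (v F).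

Let ax := underlying_circuits om.

(** The chirotopes of the separate lines glued into one function of pairs. Their global signs need
    no coordination: in Menelaus' identity each line contributes two factors. *)
Definition pair_chi j k : K := chi K (v (mjoin C [set j] [set k])) j k.

Lemma pair_chiE F j k : rank2flat C F -> j \in F -> k \in F -> j != k ->
  pair_chi j k = chi K (v F) j k.
Proof.
move=> rF jF kF jk; rewrite /pair_chi line_closure //.
by rewrite -(rank2_eq_line simple rF jF kF jk).
Qed.

Lemma det2_neq0 F j k : rank2flat C F -> j \in F -> k \in F -> j != k ->
  det2 (v F j) (v F k) != 0.
Proof.
move=> rF jF kF jk; apply/eqP => /(dependent_pair jk)[X vX sX].
have sF : ssupp X \subset F by apply: subset_trans sX _; rewrite subUset !sub1set jF.
have XC : ssupp X \in C by apply/underlyingP; exists X => //; apply/(real rF sF).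
by have := small_circuit2 simple j k XC; rewrite sX.
Qed.

Lemma pair_chi_sym j k : j != k -> pair_chi j k = -1 * pair_chi k j.
Proof. by move=> jk; rewrite /pair_chi /mjoin setUC !chiE det2C sgn_inN mulN1r. Qed.

Lemma pair_chi_sq j k : j != k -> pair_chi j k * pair_chi j k = 1.
Proof.
move=> jk; have rF := rank2_line ax simple jk.
rewrite (pair_chiE rF) ?inE /mem_line ?eqxx ?orbT // chiE sgn_in_sq // det2_neq0 //.
  by rewrite inE /mem_line eqxx.
by rewrite inE /mem_line eqxx orbT.
Qed.

Lemma sgn_epsE (X : signed n) a : sgn_eps K X a = (-1) ^+ (a \notin X.1).
Proof. by rewrite /sgn_eps; case: (a \in X.1); rewrite ?expr0 ?expr1. Qed.

Lemma sgn_eps_sq (X : signed n) a : sgn_eps K X a * sgn_eps K X a = 1.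
Proof. by rewrite sgn_epsE -expr2 sqrr_sign. Qed.

(** Take the determinant of the linear dependency with the vector of [z]: two terms remain, and
    their signs are compared. *)
Lemma sgn_eps_chi X x y z : X \in SC -> ssupp X = [set x; y; z] ->
  sgn_eps K X x * pair_chi z x = sgn_eps K X y * pair_chi y z.
Proof.
move=> XS sX; have cc : col x y z by apply/underlyingP; exists X.
have [xy xz yz] := col_distinct simple cc.
have rF := rank2_line ax simple xy; set F := [set k | _] in rF.
have xF : x \in F by rewrite inE /mem_line eqxx.
have yF : y \in F by rewrite inE /mem_line eqxx orbT.
have zF : z \in F by rewrite inE /mem_line cc !orbT.
have sF : ssupp X \subset F by rewrite sX !subUset !sub1set xF yF.
have /(real rF sF)[_ _ [lam [l1 l2 l0 e1 e2]] _] := XS.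
have sup k : lam k != 0 -> k \in [set x; y; z].
  by rewrite -sX; apply: contraNT => /l0->.
rewrite !(sum_supp3 _ xy xz yz sup) in e1 e2.
have epsE a : a \in [set x; y; z] -> sgn_eps K X a = sgn_in K (lam a).
  rewrite -sX => aX; rewrite /sgn_eps /sgn_in; case: (boolP (a \in X.1)) => [/l1->//|a1].
  by rewrite ltNge ltW l2 //= (signed2 om XS) ?a1.
rewrite !(pair_chiE rF) // 1?eq_sym // !chiE !epsE ?inE ?eqxx ?orbT // -!sgn_inM.
congr sgn_in; rewrite /det2.
have h1 : lam x * (v F x).1 = - (lam y * (v F y).1 + lam z * (v F z).1).
  by apply/eqP; rewrite -addr_eq0 addrA e1.
have h2 : lam x * (v F x).2 = - (lam y * (v F y).2 + lam z * (v F z).2).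
  by apply/eqP; rewrite -addr_eq0 addrA e2.
transitivity ((v F z).1 * (lam x * (v F x).2) - (v F z).2 * (lam x * (v F x).1)); first ring.
rewrite h1 h2; ring.
Qed.

Lemma pair_chi_line X x y z : X \in SC -> ssupp X = [set x; y; z] ->
  pair_chi z y = - ((-1) ^+ ((x \in X.1) (+) (y \in X.1)) * pair_chi z x).
Proof.
move=> XS sX; have cc : col x y z by apply/underlyingP; exists X.
have [xy xz yz] := col_distinct simple cc.
have -> : (-1) ^+ ((x \in X.1) (+) (y \in X.1)) = sgn_eps K X x * sgn_eps K X y.
  by rewrite !sgn_epsE -signr_addb; case: (x \in X.1); case: (y \in X.1).
rewrite [sgn_eps K X x * _]mulrC -mulrA (sgn_eps_chi XS sX) mulrA sgn_eps_sq mul1r.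
by rewrite pair_chi_sym 1?eq_sym // mulN1r.
Qed.

(** For Menelaus, [pair_chi_line] rewrites one factor on each of the three lines; what does not
    square to one is the parity in [signed_menelaus]. *)
Lemma vg_sign : sign_axioms col (-1 : K) pair_chi.
Proof.
split.
- by rewrite mulrNN mulr1.
- exact: pair_chi_sym.
- exact: pair_chi_sq.
move=> j h h' k l m cG cL cP cQ nc.
have [G GS sG] := signed_of_col cG; have [P PS sP] := signed_of_col cP.
have [Q QS sQ] := signed_of_col cQ.
have := signed_menelaus om simple cG cL cP cQ nc GS PS QS sG sP sQ.
set bG := (h \in G.1) (+) (h' \in G.1); set bP := (h \in P.1) (+) (m \in P.1).
set bQ := (h' \in Q.1) (+) (m \in Q.1) => H.
have sG' : ssupp G = [set h; h'; j] by rewrite sG -setUA setUC.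
have sP' : ssupp P = [set h; m; k] by rewrite sP setUAC.
have sQ' : ssupp Q = [set h'; m; l] by rewrite sQ setUAC.
have [hk _ _] := col_distinct simple cP; have [h'l _ _] := col_distinct simple cQ.
rewrite (pair_chi_line GS sG') (pair_chi_line PS sP') (pair_chi_line QS sQ') -/bG -/bP -/bQ.
rewrite eq_sym in hk; rewrite eq_sym in h'l.
have := pair_chi_sq hk; have := pair_chi_sq h'l.
set x := pair_chi k h; set y := pair_chi l h'; set z := pair_chi j h => yy xx.
transitivity (- ((-1) ^+ bP * z * (x * x))); first ring.
transitivity ((-1) ^+ bG * (-1) ^+ bQ * z * (y * y)); last ring.
rewrite xx yy !mulr1 -mulNr; congr (_ * _).
move: H; case: bG; case: bP; case: bQ => //= _;
  by rewrite ?expr0 ?expr1 ?mulr1 ?mul1r ?opprK ?mulrNN ?mulr1.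
Qed.

Lemma vg_dual q : dual_gens (VG_gens K SC) q <->
  homog2 q /\ dual_form col (-1 : K) pair_chi (fun a b => q [:: a; b]).
Proof.
apply: (@dual_gensP _ _ _ simple _ _ vg_sign (signed n) (fun X => X \in SC) (@ssupp n)
  (@sgn_eps K n)).
- by move=> X XS; apply/underlyingP; exists X.
- by move=> X /underlyingP.
- move=> X a b d XS e; have sX := triple_circuit e.
  have cc : col a b d by apply/underlyingP; exists X.
  have [ab ad bd] := col_distinct simple cc.
  have sX' : ssupp X = [set b; d; a] by rewrite sX -setUA setUC.
  have e1 := sgn_eps_chi XS sX; have e2 := sgn_eps_chi XS sX'.
  have q1 := pair_chi_sq bd; have q2 := pair_chi_sq ab; have q3 := pair_chi_sq ad.
  have s1 := pair_chi_sym ad; have s2 := sgn_eps_sq X a.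
  have q3' : pair_chi d a * pair_chi d a = 1 by rewrite pair_chi_sq // eq_sym.
  have f1 : sgn_eps K X b = sgn_eps K X a * pair_chi d a * pair_chi b d.
    by rewrite e1 -mulrA q1 mulr1.
  (* The scalar is forced by the coefficient of [a], since [pair_chi b d] squares to one. *)
  exists (sgn_eps K X a * pair_chi b d); split.
  - apply/eqP => h; have : (sgn_eps K X a * sgn_eps K X a) * (pair_chi b d * pair_chi b d) = 0.
      by rewrite mulrACA h mul0r.
    by rewrite s2 q1 mulr1 => /eqP; rewrite oner_eq0.
  - by rewrite -mulrA q1 mulr1.
  - by rewrite f1 s1 mulN1r; ring.
  have f2 : sgn_eps K X d = sgn_eps K X b * pair_chi a b * pair_chi d a.
    by rewrite e2 -mulrA q3' mulr1.
  rewrite f2 f1.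
  transitivity (sgn_eps K X a * pair_chi b d * pair_chi a b * (pair_chi d a * pair_chi d a)).
    ring.
  by rewrite q3' mulr1.
move=> g; split; case=> [[i e]|[i [j e]]|[X XS e]];
  [constructor 1; by exists i | constructor 2; exists i, j | constructor 3; by exists X |
   constructor 1; by exists i | constructor 2; exists i, j | constructor 3; by exists X];
  by move=> w; rewrite e mulN1r.
Qed.

Hypotheses (rk : mrank C setT = r) (part : good_partition C blk).

Lemma vg_conclusions : let J := koszul_dual_ideal (VG_gens K SC) in
  [/\ groebner (word_lt blk) (fun g => exists F j, [/\ rank2flat C F, j \in F &
                              forall w, g w = rpm_flat K (v F) F j w]) J,
      reduced_groebner (word_lt blk) (fun g => exists j i, retrograde blk j i /\
                              forall w, g w = rpm_retro K C v j i w) J,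
      (forall j i, retrograde blk j i -> is_lm (word_lt blk) (rpm_retro K C v j i) [:: j; i]) &
      common_conclusions blk (word_lt blk) J].
Proof.
apply: (matroid_conclusions ax simple rk part vg_sign vg_dual
  (rho_flat := fun F => rpm_flat K (v F) F)).
- move=> F j rF jF w; apply: eq_bigr => k /andP[kF kj].
  by rewrite (pair_chiE rF) // 1?eq_sym // mulN1r opprK.
move=> j i lt w; have ji : j != i by apply: contraTneq lt => ->; rewrite ltnn.
rewrite /retro_rel /line_rel (sum_punctured ax simple rk part) // mulrDr mulrA.
rewrite pair_chi_sq // mul1r mulN1r opprK; congr (_ + _ * _).
have rF := rank2_line ax simple ji; rewrite line_closure //.
apply: eq_bigr => k /andP[kF /andP[ki kj]].
rewrite (pair_chiE rF) ?mulN1r ?opprK // 1?eq_sym //.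
by rewrite inE /mem_line eqxx.
Qed.
End VarchenkoGelfand.

Theorem theorem5p18 (K : fieldType) (R : realFieldType) (n r : nat) (blk : 'I_n -> 'I_r) :
  (* the Orlik-Solomon case *)
  (forall C : {set {set 'I_n}},
     circuit_axioms C -> simple_matroid C -> supersolvable C -> mrank C setT = r ->
     good_partition C blk ->
     exists ord : rel (word n), monomial_order ord /\
       let J := koszul_dual_ideal (OS_gens K C) in
       [/\ groebner ord (fun g => exists F j, [/\ rank2flat C F, j \in F &
                                   forall w, g w = r_flat K F j w]) J,
           reduced_groebner ord (fun g => exists j i, retrograde blk j i /\
                                   forall w, g w = r_retro K C j i w) J,
           (forall j i, retrograde blk j i -> is_lm ord (r_retro K C j i) [:: j; i]) &
           common_conclusions blk ord J]) /\
  (* the Varchenko-Gelfand case *)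
  (forall (SC : {set signed n}) (v : {set 'I_n} -> 'I_n -> R * R),
     om_axioms SC ->
     simple_matroid (underlying SC) -> supersolvable (underlying SC) ->
     mrank (underlying SC) setT = r -> good_partition (underlying SC) blk ->
     (forall F, rank2flat (underlying SC) F -> realizes SC F (v F)) ->
     exists ord : rel (word n), monomial_order ord /\
       let J := koszul_dual_ideal (VG_gens K SC) in
       [/\ groebner ord (fun g => exists F j, [/\ rank2flat (underlying SC) F, j \in F &
                                   forall w, g w = rpm_flat K (v F) F j w]) J,
           reduced_groebner ord (fun g => exists j i, retrograde blk j i /\
                                   forall w, g w = rpm_retro K (underlying SC) v j i w) J,
           (forall j i, retrograde blk j i ->
              is_lm ord (rpm_retro K (underlying SC) v j i) [:: j; i]) &
           common_conclusions blk ord J]).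
Proof.
split=> [C ax simple _ rk part|SC v om simple _ rk part real]; exists (word_lt blk).
  by split; [exact: word_lt_order | exact: os_conclusions].
by split; [exact: word_lt_order | exact: vg_conclusions].
Qed.
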